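(* For all integers $n,k$, the mappings $\Phi'$ and $\Psi'$ induce successive bijections between (a) well-labelled positive paths of size $n$ with $k$ horizontal steps, (b) marked labelled binary trees with $n$ leaves, $k$ of which are quasi-single leaves, and (c) matchings on $[2n]$ having $k$ pairs $(i,j)$ with $i\in\{1,\ldots,n\}$ and $j\in\{n+1,\ldots,2n-1\}$.
   Context: A well-labelled path of size $n$ is a pair $(\mathbf{p},\sigma)$ where $\mathbf{p}=p_1\ldots p_{n-1}$ is a word on $\{-1,0,+1\}$ and $\sigma$ is a permutation of $[n]$ such that $p_i=-1$ implies $\sigma_i<\sigma_{i+1}$ and $p_i=1$ implies $\sigma_i>\sigma_{i+1}$. It is Motzkin if $\sum_{i=1}^j p_i\ge 0$ for $j\le n-2$ and $\sum_{i=1}^{n-1}p_i=-1$; positive if $\sum_{i=1}^j p_i\ge0$ for all $j\le n-1$. A horizontal step is a letter $0$ in $\mathbf{p}$. For a set $I$ of $m$ integers, $\lambda_I$ is the order-preserving bijection $[m]\to I$. A labelled binary tree of size $n$ is a rooted tree with $n$ leaves carrying distinct labels in $[n]$, each internal vertex having exactly two unordered children; a marked one has one marked vertex (internal or leaf). $\lambda(\tau)$ replaces each leaf label $i$ by $\lambda(i)$. A leaf of a marked tree is quasi-single if it is not marked and its sibling is either marked or internal. A matching on $[2n]$ is a fixed-point-free involution. $\Phi$ (Motzkin paths of size $n\ge2$ to labelled binary trees): (i) the size-2 path maps to the size-2 tree; (ii) if $n>2$, $p_1=0$: with $\mathbf{p}'=p_2\ldots p_{n-1}$, $\sigma'_i=\lambda^{-1}_{[n]\setminus\{\sigma_1\}}(\sigma_{i+1})$,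 the image is a root with a leaf labelled $\sigma_1$ and subtree $\lambda_{[n]\setminus\{\sigma_1\}}(\Phi(\mathbf{p}',\sigma'))$; (iii) if $n>2$, $p_1=1$: $k$ least with $\sum_{i=1}^kp_i=0$, $I'=\{\sigma_1..\sigma_k\}$, $I''=\{\sigma_{k+1}..\sigma_n\}$, $p'_i=-p_{k-i}$, $p''_i=p_{k+i}$, $\sigma'_i=\lambda^{-1}_{I'}(\sigma_{k+1-i})$, $\sigma''_i=\lambda^{-1}_{I''}(\sigma_{k+i})$; the image is a root with subtrees $\lambda_{I'}(\Phi(\mathbf{p}',\sigma'))$, $\lambda_{I''}(\Phi(\mathbf{p}'',\sigma''))$. $\Phi'$ (positive paths to marked trees): (i) size-1 path maps to a single marked leaf; (ii) if $n>1$, $p_1=0$: unmarked root, unmarked leaf $\sigma_1$, marked subtree $\lambda_{[n]\setminus\{\sigma_1\}}(\Phi'(\mathbf{p}',\sigma'))$; (iii) if $n>1$, $p_1=1$: $k\le n$ greatest with $\sum_{i=1}^{j-1}p_i\ge1$ for $j=2..k-1$ and $\sum_{i=1}^{k-1}p_i=1$, pieces defined by the same formulas; if $k=n$ the image is $\Phi(\mathbf{p}',\sigma')$ with root marked, otherwise an unmarked root with unmarked subtree $\lambda_{I'}(\Phi(\mathbf{p}',\sigma'))$ and marked subtree $\lambda_{I''}(\Phi'(\mathbf{p}'',\sigma''))$. $\Psi$ (Chen's bijection, labelled binary trees with $n$ leaves to matchings on $[2n-2]$): label the $n-2$ internal non-root vertices: repeatedly, among unlabelled non-root vertices both of whose children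 are labelled, take the one having the child with least label and give it the least unused label in $\{n+1,\ldots,2n-2\}$; then $\pi(i)=j$ whenever $i,j$ are labels of siblings. $\Psi'$ (marked trees with $n$ leaves to matchings on $[2n]$): let $\pi=\Psi(\tau)$ for the unmarked tree $\tau$; if the marked vertex is the root, $\pi'$ agrees with $\pi$ on $[2n-2]$ and $\pi'(2n-1)=2n$; otherwise, with $k$ the label of the marked vertex and $l$ that of its sibling, $\pi'(i)=\pi(i)$ for $i\ne k,l$, $\pi'(k)=2n$, $\pi'(l)=2n-1$. *)

(* Defs.v *)
From mathcomp Require Import all_boot all_order all_algebra.
Set Implicit Arguments. Unset Strict Implicit. Unset Printing Implicit Defensive.
Import GRing.Theory Num.Theory.

(* Well-labelled paths: p = p_1..p_{n-1} (seq int), sigma = seq nat.  *)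
(* Indices in the paper are 1-based; p_i = nth 0 p i.-1 etc.          *)

Definition psum (p : seq int) (j : nat) : int := foldr (fun x acc => x + acc)%R 0%R (take j p).

Definition well_labelled (n : nat) (P : seq int * seq nat) : bool :=
  let p := P.1 in let s := P.2 in
  [&& size s == n, (size p).+1 == n,
      all (fun x => x \in [:: (-1)%R; 0%R; 1%R]) p,
      perm_eq s (iota 1 n) &
      all (fun i => ((nth 0%R p i == (-1)%R) ==> (nth 0 s i < nth 0 s i.+1)) &&
                    ((nth 0%R p i == 1%R) ==> (nth 0 s i > nth 0 s i.+1)))
          (iota 0 (size p))].

Definition motzkin (P : seq int * seq nat) : bool :=
  let n := size P.2 in
  all (fun j => (0 <= psum P.1 j)%R) (iota 1 (n - 2)) && (psum P.1 (n - 1) == (-1)%R).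

Definition positive (P : seq int * seq nat) : bool :=
  let n := size P.2 in all (fun j => (0 <= psum P.1 j)%R) (iota 1 (n - 1)).

Definition horizontal_steps (p : seq int) : nat := count (fun x => x == 0%R) p.

Definition lam (I : seq nat) (i : nat) : nat := nth 0 (sort leq I) i.-1.
Definition lam_inv (I : seq nat) (x : nat) : nat := (index x (sort leq I)).+1.

(* Binary trees with leaf labels and a mark flag on every vertex.      *)
(* Unordered trees are represented by their canonical ordered form     *)
(* (left child = the one containing the smaller least leaf label).     *)
Inductive btree := BLeaf of bool & nat | BNode of bool & btree & btree.

Definition root_mark (t : btree) : bool :=
  match t with BLeaf m _ => m | BNode m _ _ => m end.
Definition is_node (t : btree) : bool :=
  match t with BLeaf _ _ => false | BNode _ _ _ => true end.
Definition mark_root (t : btree) : btree :=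
  match t with BLeaf _ x => BLeaf true x | BNode _ l r => BNode true l r end.

Fixpoint leaves (t : btree) : seq nat :=
  match t with BLeaf _ x => [:: x] | BNode _ l r => leaves l ++ leaves r end.
Fixpoint minleaf (t : btree) : nat :=
  match t with BLeaf _ x => x | BNode _ l r => minn (minleaf l) (minleaf r) end.
Fixpoint nmarks (t : btree) : nat :=
  match t with BLeaf m _ => m | BNode m l r => m + nmarks l + nmarks r end.
Fixpoint unmark (t : btree) : btree :=
  match t with BLeaf _ x => BLeaf false x | BNode _ l r => BNode false (unmark l) (unmark r) end.
Fixpoint relabel (f : nat -> nat) (t : btree) : btree :=
  match t with BLeaf m x => BLeaf m (f x) | BNode m l r => BNode m (relabel f l) (relabel f r) end.
Fixpoint canon (t : btree) : btree :=
  match t with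
  | BLeaf m x => BLeaf m x
  | BNode m l r => let l' := canon l in let r' := canon r in
      if minleaf l' <= minleaf r' then BNode m l' r' else BNode m r' l'
  end.
Fixpoint is_canon (t : btree) : bool :=
  match t with
  | BLeaf _ _ => true
  | BNode _ l r => [&& minleaf l < minleaf r, is_canon l & is_canon r]
  end.

(* x is a quasi-single leaf whose sibling is y *)
Definition is_qs (x y : btree) : bool :=
  match x with BLeaf m _ => ~~ m && (root_mark y || is_node y) | _ => false end.
Fixpoint nqs (t : btree) : nat :=
  match t with
  | BLeaf _ _ => 0
  | BNode _ l r => is_qs l r + is_qs r l + nqs l + nqs r
  end.

Definition labelled_tree (n : nat) (t : btree) : bool :=
  [&& perm_eq (leaves t) (iota 1 n), is_canon t & nmarks t == 0].
Definition marked_tree (n k : nat) (t : btree) : bool :=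
  [&& perm_eq (leaves t) (iota 1 n), is_canon t, nmarks t == 1 & nqs t == k].

Definition first_zero (p : seq int) : nat :=
  head 0 [seq j <- iota 1 (size p) | psum p j == 0%R].

Fixpoint Phi_f (fuel : nat) (p : seq int) (s : seq nat) {struct fuel} : btree :=
  match fuel with
  | 0 => BLeaf false 0
  | fuel'.+1 =>
    let n := size s in
    if n <= 2 then BNode false (BLeaf false 1) (BLeaf false 2)
    else if head 0%R p == 0%R then
      let I := [seq y <- iota 1 n | y != head 0 s] in
      BNode false (BLeaf false (head 0 s))
        (relabel (lam I) (Phi_f fuel' (behead p) (map (lam_inv I) (behead s))))
    else if head 0%R p == 1%R then
      let k := first_zero p in
      let I1 := take k s in let I2 := drop k s in
      let p1 := map (fun x => - x)%R (rev (take k.-1 p)) in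
      let p2 := drop k p in
      let s1 := map (lam_inv I1) (rev (take k s)) in
      let s2 := map (lam_inv I2) (drop k s) in
      BNode false (relabel (lam I1) (Phi_f fuel' p1 s1))
                  (relabel (lam I2) (Phi_f fuel' p2 s2))
    else BLeaf false 0
  end.

Definition Phi (p : seq int) (s : seq nat) : btree := canon (Phi_f (size s) p s).

Definition last_k (p : seq int) (n : nat) : nat :=
  last 2 [seq k <- iota 2 (n - 1) |
           all (fun j => (1 <= psum p j)%R) (iota 1 (k - 2)) && (psum p k.-1 == 1%R)].

Fixpoint Phi'_f (fuel : nat) (p : seq int) (s : seq nat) {struct fuel} : btree :=
  match fuel with
  | 0 => BLeaf true 0
  | fuel'.+1 =>
    let n := size s in
    if n <= 1 then BLeaf true 1
    else if head 0%R p == 0%R then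
      let I := [seq y <- iota 1 n | y != head 0 s] in
      BNode false (BLeaf false (head 0 s))
        (relabel (lam I) (Phi'_f fuel' (behead p) (map (lam_inv I) (behead s))))
    else if head 0%R p == 1%R then
      let k := last_k p n in
      let I1 := take k s in let I2 := drop k s in
      let p1 := map (fun x => - x)%R (rev (take k.-1 p)) in
      let p2 := drop k p in
      let s1 := map (lam_inv I1) (rev (take k s)) in
      let s2 := map (lam_inv I2) (drop k s) in
      if k == n then mark_root (Phi p1 s1)
      else BNode false (relabel (lam I1) (Phi p1 s1))
                       (relabel (lam I2) (Phi'_f fuel' p2 s2))
    else BLeaf true 0
  end.

Definition Phi' (P : seq int * seq nat) : btree := canon (Phi'_f (size P.2) P.1 P.2).

(* Chen's bijection Psi and Psi'.  Vertices are addressed by the path  *)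
(* from the root (false = left child, true = right child).             *)
Fixpoint addrs (t : btree) : seq (seq bool) :=
  match t with
  | BLeaf _ _ => [:: [::]]
  | BNode _ l r => [::] :: map (cons false) (addrs l) ++ map (cons true) (addrs r)
  end.
Fixpoint subt (t : btree) (a : seq bool) : option btree :=
  match a with
  | [::] => Some t
  | b :: a' => match t with BLeaf _ _ => None | BNode _ l r => subt (if b then r else l) a' end
  end.
Fixpoint leafaddrs (t : btree) : seq (seq bool * nat) :=
  match t with
  | BLeaf _ x => [:: ([::], x)]
  | BNode _ l r => map (fun q => (false :: q.1, q.2)) (leafaddrs l)
                ++ map (fun q => (true :: q.1, q.2)) (leafaddrs r)
  end.
Definition sibling (a : seq bool) : seq bool := rcons (take (size a).-1 a) (~~ last false a).
Definition internal_nonroot (t : btree) : seq (seq bool) :=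
  [seq a <- addrs t | (a != [::]) && (if subt t a is Some u then is_node u else false)].

Definition lookup (L : seq (seq bool * nat)) (a : seq bool) : option nat :=
  omap snd (ohead [seq q <- L | q.1 == a]).
Definition addr_of (L : seq (seq bool * nat)) (i : nat) : seq bool :=
  head [::] [seq q.1 | q <- L & q.2 == i].

Definition chen_step (t : btree) (L : seq (seq bool * nat)) (lbl : nat) :=
  let cand := [seq a <- internal_nonroot t | [&& lookup L a == None,
                 lookup L (rcons a false) != None & lookup L (rcons a true) != None]] in
  let key a := minn (odflt 0 (lookup L (rcons a false))) (odflt 0 (lookup L (rcons a true))) in
  match sort (fun a b => key a <= key b) cand with
  | [::] => L
  | a :: _ => (a, lbl) :: L
  end.
Fixpoint chen_iter (t : btree) (L : seq (seq bool * nat)) (n i steps : nat) :=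
  match steps with
  | 0 => L
  | st.+1 => chen_iter t (chen_step t L (n + 1 + i)) n i.+1 st
  end.
(* labels of all non-root vertices: leaves keep their labels, internal
   non-root vertices get n+1..2n-2 by Chen's greedy rule *)
Definition chen_labels (t : btree) :=
  let n := size (leaves t) in chen_iter t (leafaddrs t) n 0 (n - 2).

(* matchings on [m] are encoded as the sequence pi(1), ..., pi(m) *)
Definition Psi (t : btree) : seq nat :=
  let L := chen_labels t in let n := size (leaves t) in
  [seq odflt 0 (lookup L (sibling (addr_of L i))) | i <- iota 1 (2 * n - 2)].

Definition marked_addr (t : btree) : seq bool :=
  head [::] [seq a <- addrs t | if subt t a is Some u then root_mark u else false].

Definition Psi' (t : btree) : seq nat :=
  let n := size (leaves t) in
  let t0 := unmark t in
  let L := chen_labels t0 in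
  let pi := Psi t0 in
  let ma := marked_addr t in
  if ma == [::] then pi ++ [:: 2 * n; 2 * n - 1]
  else
    let kk := odflt 0 (lookup L ma) in
    let l := odflt 0 (lookup L (sibling ma)) in
    [seq (if i == kk then 2 * n else if i == l then 2 * n - 1 else nth 0 pi i.-1)
     | i <- iota 1 (2 * n - 2)] ++ [:: l; kk].

Definition is_matching (m : nat) (pi : seq nat) : bool :=
  (size pi == m) &&
  all (fun i => let j := nth 0 pi i.-1 in [&& 1 <= j, j <= m, j != i & nth 0 pi j.-1 == i])
      (iota 1 m).

Definition matching_stat (n k : nat) (pi : seq nat) : bool :=
  is_matching (2 * n) pi &&
  (count (fun i => n < nth 0 pi i.-1 <= 2 * n - 1) (iota 1 n) == k).

Definition pos_path (n k : nat) (P : seq int * seq nat) : bool :=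
  [&& well_labelled n P, positive P & horizontal_steps P.1 == k].

Definition bij_on {X Y : Type} (A : X -> bool) (B : Y -> bool) (f : X -> Y) : Prop :=
  (forall x, A x -> B (f x)) /\
  (forall x y, A x -> A y -> f x = f y -> x = y) /\
  (forall y, B y -> exists x, A x /\ f x = y).

(* Main.v *)
Require Import Defs.
From mathcomp Require Import all_boot all_order all_algebra zify.
Set Implicit Arguments. Unset Strict Implicit. Unset Printing Implicit Defensive.
Import GRing.Theory Num.Theory.

(* Phi' is inverted by reading a path off a tree.  Cutting a Motzkin path at its
   first return to 0 removes a down step between the first labels of the two
   pieces, so exactly one order of the two subtrees is admissible; cutting a
   positive path at the last admissible k removes a nonzero step whose sign is
   forced by the labels on both sides of it.  Horizontal steps are thus created
   exactly by the leaves hanging alone.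

   For Psi', all vertices are labelled, the root receiving 2n-1.  Chen's labelling
   is characterised by two local conditions: labels increase towards the root, and
   if c < c' while both children of c' are labelled below c, then the least child
   label of c is below that of c'.  Every tree carries such a labelling (contract
   the cherry with least label and induct), every matching of siblings is realised
   by one (contract the pair with least label and induct), and the two conditions
   determine the labelled tree from its sibling matching.  The marked vertex is the
   partner of 2n. *)

(** * Partial sums and well-labelled paths *)

(** The recursive definitions standardise the labels at every call and store unordered trees in an
    ordered form, and neither fits a direct induction. Labels are therefore allowed to be arbitrary
    distinct numbers, all relabellings being pushed outwards once, and trees are compared only after
    [canon], with inverse maps that do not see the order of the two children.

    Giving the root the label 2n-1 makes the rule for the marked vertex uniform: when the root is
    marked, 2n-1 and 2n are indeed partners. The statistic then comes from three cases for a leaf.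
    If it is marked, its partner is 2n; if its sibling is marked, its partner is 2n-1; otherwise its
    partner is the label of its sibling, which exceeds n exactly when the sibling is internal. So
    being quasi-single means having a partner between n+1 and 2n-1. *)

Definition negrev (p : seq int) : seq int := [seq (- x)%R | x <- rev p].

Lemma psum0 p : psum p 0 = 0%R. Proof. by rewrite /psum take0. Qed.

Lemma psum_nil j : psum [::] j = 0%R. Proof. by []. Qed.

Lemma psum_cons x p j : psum (x :: p) j.+1 = (x + psum p j)%R.
Proof. by []. Qed.

Lemma psum_cat p q j : psum (p ++ q) j = (psum p j + psum q (j - size p))%R.
Proof.
elim: p j => [|x p IH] [|j] /=; rewrite ?psum_nil ?psum0 ?subn0 ?add0r //.
by rewrite !psum_cons IH addrA subSS.
Qed.

Lemma psum_oversize p j : size p <= j -> psum p j = psum p (size p).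
Proof. by move=> h; rewrite /psum !take_oversize. Qed.

Lemma psumS (p : seq int) j : psum p j.+1 = (psum p j + nth 0%R p j)%R.
Proof.
elim: p j => [|x p IH] [|j]; rewrite ?psum_nil ?nth_nil ?addr0 //.
  by rewrite psum_cons !psum0 addr0 add0r.
by rewrite !psum_cons IH addrA.
Qed.

Lemma psum_take (p : seq int) k j : j <= k -> psum (take k p) j = psum p j.
Proof. by move=> h; rewrite /psum take_takel. Qed.

Lemma psum_drop (p : seq int) k j : k <= size p ->
  psum (drop k p) j = (psum p (k + j) - psum p k)%R.
Proof.
move=> h; rewrite -{2 3}(cat_take_drop k p) !psum_cat size_takel //.
rewrite subnn psum0 addr0 addKn [psum _ (k + j)]psum_oversize ?size_takel ?leq_addr //.
by rewrite addrC addKr.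
Qed.

Lemma size_negrev p : size (negrev p) = size p.
Proof. by rewrite size_map size_rev. Qed.

Lemma negrev_cons x p : negrev (x :: p) = negrev p ++ [:: - x]%R.
Proof. by rewrite /negrev rev_cons map_rcons cats1. Qed.

Lemma negrevK : involutive negrev.
Proof.
move=> p; rewrite /negrev -map_rev revK -map_comp map_id_in // => x _ /=.
by rewrite opprK.
Qed.

(** The walk read backwards with opposite steps visits the same heights in reverse order, translated
    so as to start at 0. Negating the steps compensates the reversal of the labels, so the label
    conditions survive. *)
Lemma psum_negrev p j :
  psum (negrev p) j = (psum p (size p - j) - psum p (size p))%R.
Proof.
elim: p j => [|x p IH] j; first by rewrite psum_nil.
rewrite negrev_cons psum_cat IH size_negrev /=.
case: (leqP j (size p)) => h.
  rewrite (eqP h) psum0 addr0 subSn // !psum_cons; lia.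
have -> : j - size p = (j - size p).-1.+1 by lia.
have -> : size p - j = 0 by lia.
have -> : (size p).+1 - j = 0 by lia.
rewrite !psum_cons !psum0 psum_nil; lia.
Qed.

Definition step_ok (x : int) (a b : nat) : bool :=
  [|| x == 0%R, (x == -1)%R && (a < b) | (x == 1%R) && (b < a)].

(** Well-labelling freed from the condition that the labels form [[n]], so that the two pieces of a
    cut inherit it. The shape of the recursion also forces one more label than steps. *)
Fixpoint wlab (p : seq int) (s : seq nat) : bool :=
  match p, s with
  | [::], [:: _] => true
  | x :: p', a :: s' => step_ok x a (head 0 s') && wlab p' s'
  | _, _ => false
  end.

Lemma wlab_size p s : wlab p s -> size s = (size p).+1.
Proof.
elim: p s => [|x p IH] [|a s] //=; first by case: s.
by case/andP=> _ /IH ->.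
Qed.

Lemma wlab_cat p1 s1 x p2 s2 : size s1 = (size p1).+1 ->
  wlab (p1 ++ x :: p2) (s1 ++ s2) =
  [&& wlab p1 s1, step_ok x (last 0 s1) (head 0 s2) & wlab p2 s2].
Proof.
elim: p1 s1 => [|y p1 IH] [|a s1] //= [].
  by move/size0nil=> ->.
case: s1 => // b s1 hs.
by rewrite (IH (b :: s1)) //= -!andbA.
Qed.

Lemma step_okN x a b : step_ok (- x)%R b a = step_ok x a b.
Proof. rewrite /step_ok; lia. Qed.

Lemma wlab_negrev p s : wlab p s -> wlab (negrev p) (rev s).
Proof.
elim: p s => [|x p IH] [|a s] //; first by case: s.
case: s => [|b s] /= /andP[hs hw]; first by case: (p) hw.
rewrite rev_cons -cats1 negrev_cons wlab_cat.
  by rewrite IH //= rev_cons last_rcons step_okN hs.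
by rewrite size_rev size_negrev (wlab_size hw).
Qed.

Lemma wlab_split (p : seq int) s k : wlab p s -> 0 < k -> k < size s ->
  p = take k.-1 p ++ nth 0%R p k.-1 :: drop k p /\
  [&& wlab (take k.-1 p) (take k s),
      step_ok (nth 0%R p k.-1) (last 0 (take k s)) (head 0 (drop k s))
    & wlab (drop k p) (drop k s)].
Proof.
move=> hw k0 ks; have hs := wlab_size hw.
have e : p = take k.-1 p ++ nth 0%R p k.-1 :: drop k p.
  have hk : k.-1 < size p by lia.
  by have := cat_take_drop k.-1 p; rewrite (drop_nth 0%R hk) prednK.
split=> //; move: hw; rewrite {1}e -{1}(cat_take_drop k s) wlab_cat //.
rewrite !size_takel; lia.
Qed.

Lemma wlabP (p : seq int) s : reflect (size s = (size p).+1 /\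
   forall i, i < size p -> step_ok (nth 0%R p i) (nth 0 s i) (nth 0 s i.+1))
  (wlab p s).
Proof.
elim: p s => [|x p IH] [|a s] /=.
- by constructor; case.
- by case: s => [|b s] /=; constructor; [split | case].
- by constructor; case.
apply: (iffP andP) => [[h1 /IH[h2 h3]]|[[h2] h3]].
  split; first by rewrite h2.
  by case=> [|i] hi /=; [rewrite nth0 | apply: h3].
split; first by move: (h3 0 isT); rewrite /= nth0.
by apply/IH; split=> // i hi; apply: (h3 i.+1).
Qed.

Lemma wlab_map (g : nat -> nat) p s :
  {in s &, {homo g : x y / x < y}} -> wlab p s -> wlab p (map g s).
Proof.
move=> hg /wlabP[h1 h2]; apply/wlabP; rewrite size_map; split=> // i hi.
have m1 : nth 0 s i \in s by apply: mem_nth; rewrite h1; lia.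
have m2 : nth 0 s i.+1 \in s by apply: mem_nth; rewrite h1; lia.
rewrite !(nth_map 0); try lia.
move: (h2 i hi); rewrite /step_ok => /or3P[->//|/andP[-> /= h]|/andP[-> /= h]].
  by rewrite (hg _ _ m1 m2 h) orbT.
by rewrite (hg _ _ m2 m1 h) !orbT.
Qed.

Lemma well_labelledE n (p : seq int) s :
  well_labelled n (p, s) = [&& size s == n, wlab p s & perm_eq s (iota 1 n)].
Proof.
rewrite /well_labelled /=; apply/and5P/and3P.
  move=> [h1 h2 h3 h4 h5]; split=> //; apply/wlabP; split; first lia.
  move=> i hi; move/(all_nthP 0%R): h3 => /(_ i hi).
  move/allP: h5 => /(_ i); rewrite mem_iota => /(_ hi) /andP[].
  rewrite /step_ok !inE => h6 h7 /or3P[] e; move: h6 h7; rewrite e ?orbT //=.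
    by move=> -> _; rewrite orbT.
  by move=> _ ->; rewrite !orbT.
move=> [h1 /wlabP[h2 h3] h4]; split=> //; first lia.
  apply/(all_nthP 0%R) => i /h3; rewrite !inE /step_ok.
  by case/or3P=> [->|/andP[->]|/andP[->]]; rewrite ?orbT.
apply/allP => i; rewrite mem_iota => /h3; rewrite /step_ok.
by case/or3P=> [/eqP->|/andP[/eqP-> ->]|/andP[/eqP-> ->]].
Qed.

(** * Motzkin and positive words, and the places where they are cut *)

Definition motz (p : seq int) : Prop :=
  [/\ 0 < size p, forall j, j < size p -> (0 <= psum p j)%R
    & psum p (size p) = (-1)%R].
Definition posp (p : seq int) : Prop := forall j, (0 <= psum p j)%R.

Lemma head_filter_iota (d : nat) (P : pred nat) a m k :
  a <= k < a + m -> P k -> (forall j, a <= j < k -> ~~ P j) ->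
  head d [seq j <- iota a m | P j] = k.
Proof.
move=> hk Pk hj; have -> : m = (k - a) + (m - (k - a)) by lia.
rewrite iotaD filter_cat (eq_in_filter (a2 := pred0)).
  rewrite filter_pred0 /=; have -> : m - (k - a) = (m - (k - a)).-1.+1 by lia.
  by rewrite /=; have -> : a + (k - a) = k by [lia]; rewrite Pk.
by move=> j; rewrite mem_iota => h; apply/negbTE/hj; lia.
Qed.

Lemma last_filter_iota (d : nat) (P : pred nat) a m k :
  a <= k < a + m -> P k -> (forall j, k < j < a + m -> ~~ P j) ->
  last d [seq j <- iota a m | P j] = k.
Proof.
move=> hk Pk hj; have -> : m = (k - a).+1 + (m - (k - a).+1) by lia.
rewrite iotaD filter_cat [X in _ ++ X](eq_in_filter (a2 := pred0)).
  rewrite filter_pred0 cats0 -addn1 iotaD filter_cat /=.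
  have -> : a + (k - a) = k by lia.
  by rewrite Pk last_cat.
by move=> j; rewrite mem_iota => h; apply/negbTE/hj; lia.
Qed.

Lemma first_zeroE p k : 0 < k <= size p -> psum p k = 0%R ->
  (forall j, 0 < j < k -> psum p j <> 0%R) -> first_zero p = k.
Proof.
move=> h1 h2 h3; apply: head_filter_iota; [lia | exact/eqP |].
by move=> j hj; apply/eqP/h3; lia.
Qed.

Lemma last_kE p n k : 1 < k <= n -> (forall j, 0 < j < k.-1 -> (1 <= psum p j)%R) ->
  psum p k.-1 = 1%R ->
  (forall i, k < i <= n -> psum p i.-1 = 1%R ->
     exists2 j, 0 < j < i.-1 & (psum p j < 1)%R) ->
  last_k p n = k.
Proof.
move=> h1 h2 h3 h4; apply: last_filter_iota; first lia.
  apply/andP; split; last exact/eqP.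
  by apply/allP => j; rewrite mem_iota => hj; apply: h2; lia.
move=> i hi; apply/negP => /andP[/allP ha /eqP he].
have [|j hj hlt] := h4 i _ he; first lia.
by have := ha j; rewrite mem_iota => /(_ ltac:(lia)); lia.
Qed.

Lemma wlab_step (p : seq int) s i : wlab p s -> (-1 <= nth 0%R p i <= 1)%R.
Proof.
case: (ltnP i (size p)) => [hi /wlabP[_ /(_ i hi)]|hi _].
  rewrite /step_ok; lia.
by rewrite nth_default.
Qed.

Lemma head_psum1 (p : seq int) : head 0%R p = psum p 1.
Proof. by rewrite psumS psum0 add0r nth0. Qed.

Lemma size_le_posp p : (forall j, j <= size p -> (0 <= psum p j)%R) -> posp p.
Proof.
move=> h j; case: (leqP j (size p)) => hj; first exact: h.
by rewrite psum_oversize ?h // ltnW.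
Qed.

(** The walk ends at -1 with steps of at most one unit, so it stands at 0 just before its last step:
    a first return k exists before the end. Between the start and k the heights are at least 1, so
    the prefix of length k-1 climbs from 0 to 1, and its reversal, starting again at 0, reaches -1
    only at its end. *)
Lemma motz_split (p : seq int) s : motz p -> wlab p s -> 2 < size s -> head 0%R p <> 0%R ->
  let k := first_zero p in
  [/\ head 0%R p = 1%R, 1 < k /\ k.+1 < size s, nth 0%R p k.-1 = (-1)%R,
      motz (negrev (take k.-1 p)) & motz (drop k p)].
Proof.
move=> [p0 p1 p2] hw hs hh; have sz := wlab_size hw.
have hd : head 0%R p = 1%R.
  by have := wlab_step 0 hw; have := p1 1 ltac:(lia); rewrite -head_psum1 nth0; lia.
have ex : exists k, (0 < k) && (psum p k == 0%R).
  exists (size p).-1; have := psumS p (size p).-1; rewrite prednK // p2.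
  have := wlab_step (size p).-1 hw; have := p1 (size p).-1 ltac:(lia); lia.
have bd := ex_minnP ex; case: bd => k /andP[k0 /eqP pk] kmin.
have kb : k <= (size p).-1.
  apply: kmin; have := psumS p (size p).-1; rewrite prednK // p2.
  have := wlab_step (size p).-1 hw; have := p1 (size p).-1 ltac:(lia); lia.
have kn j : 0 < j < k -> (1 <= psum p j)%R.
  move=> hj; have := p1 j ltac:(lia).
  case: (psum p j =P 0%R) => [e|]; last lia.
  by have := kmin j; rewrite e eqxx; lia.
have k1 : 1 < k.
  case: (k) k0 pk => // -[|//] _; rewrite -head_psum1 hd; lia.
have -> : first_zero p = k.
  apply: first_zeroE => //; first lia.
  by move=> j /kn; lia.
have pk1 : psum p k.-1 = 1%R /\ nth 0%R p k.-1 = (-1)%R.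
  have := psumS p k.-1; rewrite prednK // pk.
  have := wlab_step k.-1 hw; have := kn k.-1 ltac:(lia); lia.
have st : size (take k.-1 p) = k.-1 by rewrite size_takel //; lia.
split=> //; [lia|lia| |].
  split; rewrite ?size_negrev st; first lia.
    move=> j hj; rewrite psum_negrev st !psum_take; try lia.
    have := kn (k.-1 - j) ltac:(lia); lia.
  by rewrite psum_negrev st subnn !psum_take ?psum0; lia.
split; rewrite size_drop; first lia.
  by move=> j hj; rewrite psum_drop ?pk ?subr0 ?p1 //; lia.
by rewrite psum_drop ?subnKC ?pk ?p2 //; lia.
Qed.

(** [negrev p1] climbs to 1 without touching 0 after its start, and the inserted step is the first
    to bring the walk back to 0. *)
Lemma first_zero_join (p1 p2 : seq int) : motz p1 ->
  first_zero (negrev p1 ++ (-1)%R :: p2) = (size p1).+1.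
Proof.
move=> [h0 h1 h2]; apply: first_zeroE.
- rewrite size_cat size_negrev /=; lia.
- rewrite psum_cat psum_negrev h2 size_negrev subSn // subnn psum_cons psum0.
  have -> : size p1 - (size p1).+1 = 0 by lia.
  rewrite psum0; lia.
move=> j hj; rewrite psum_cat psum_negrev h2 size_negrev.
have -> : j - size p1 = 0 by lia.
rewrite psum0; have := h1 (size p1 - j) ltac:(lia); lia.
Qed.

Lemma motz_join (p1 p2 : seq int) : motz p1 -> motz p2 -> motz (negrev p1 ++ (-1)%R :: p2).
Proof.
move=> [h0 h1 h2] [k0 k1 k2]; split; rewrite size_cat size_negrev /=; first lia.
  move=> j hj; rewrite psum_cat psum_negrev size_negrev h2.
  case: (posnP j) => [->|j0]; first by rewrite !subn0 sub0n psum0 h2; lia.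
  case: (leqP j (size p1)) => hj1.
    have -> : j - size p1 = 0 by lia.
    rewrite psum0; have := h1 (size p1 - j) ltac:(lia); lia.
  have -> : j - size p1 = (j - size p1).-1.+1 by lia.
  have -> : size p1 - j = 0 by lia.
  rewrite psum0 psum_cons; have := k1 (j - size p1).-1 ltac:(lia); lia.
rewrite psum_cat psum_negrev size_negrev h2 addKn psum_cons k2.
have -> : size p1 - (size p1 + (size p2).+1) = 0 by lia.
rewrite psum0; lia.
Qed.

Lemma motz0 p : motz p -> motz (0%R :: p).
Proof.
move=> [h0 h1 h2]; split=> //=; last by rewrite psum_cons h2.
by case=> [|j] hj; rewrite ?psum0 // psum_cons add0r h1.
Qed.

Lemma motz_behead p : motz p -> head 0%R p = 0%R -> motz (behead p).
Proof.
case: p => [|x p] [h0 h1 h2] //= e; move: h1 h2; rewrite e => h1 h2 /=.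
split.
- by case: (p) h2 => //=; rewrite psum_cons psum_nil.
- by move=> j hj; have := h1 j.+1 hj; rewrite psum_cons add0r.
by move: h2; rewrite psum_cons add0r.
Qed.

(** Maximality of k does two things: it excludes a horizontal step after the first piece, and it
    keeps the remainder above its starting height. After a down step the remainder starts at height
    0 and the positivity of [p] suffices; after an up step it starts at 2 and can never come back to
    1. *)
Lemma posp_split (p : seq int) s : posp p -> wlab p s -> 1 < size s -> head 0%R p <> 0%R ->
  let k := last_k p (size s) in
  [/\ head 0%R p = 1%R, 1 < k <= size s, motz (negrev (take k.-1 p)) &
      k < size s -> posp (drop k p) /\ nth 0%R p k.-1 <> 0%R].
Proof.
move=> pp hw hs hh; have sz := wlab_size hw.
have hd : head 0%R p = 1%R.
  by have := wlab_step 0 hw; have := pp 1; rewrite -head_psum1 nth0; lia.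
pose Q k := [&& 1 < k <= size s, all (fun j => (1 <= psum p j)%R) (iota 1 (k - 2))
               & psum p k.-1 == 1%R].
(* The value 2 is always admissible, since the first step goes up. *)
have exQ : exists k, Q k.
  by exists 2; rewrite /Q /= -head_psum1 hd eqxx hs.
have bdQ k : Q k -> k <= size s by case/and3P; lia.
case: (ex_maxnP exQ bdQ) => k /and3P[kb /allP ka /eqP kp] kmax.
have kn j : 0 < j < k.-1 -> (1 <= psum p j)%R.
  by move=> hj; apply: ka; rewrite mem_iota; lia.
have kmax' i : k < i <= size s -> (forall j, 0 < j < i.-1 -> (1 <= psum p j)%R) ->
    psum p i.-1 <> 1%R.
  move=> hi hj e; have : i <= k.
    apply: kmax; apply/and3P; split; [lia| |exact/eqP].
    by apply/allP => j; rewrite mem_iota => h; apply: hj; lia.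
  lia.
have -> : last_k p (size s) = k.
  apply: last_kE => // i hi e.
  have : ~~ all (fun j => (1 <= psum p j)%R) (iota 1 (i - 2)).
    apply/negP => /allP h; apply: (kmax' i hi) => // j hj.
    by apply: h; rewrite mem_iota; lia.
  by case/allPn=> j; rewrite mem_iota => hj h; exists j; lia.
have st : size (take k.-1 p) = k.-1 by rewrite size_takel //; lia.
split=> //.
  split; rewrite ?size_negrev st; first lia.
    move=> j hj; rewrite psum_negrev st !psum_take; try lia.
    case: (posnP j) => [->|j0]; first by rewrite subn0 subrr.
    have := kn (k.-1 - j) ltac:(lia); lia.
  by rewrite psum_negrev st subnn !psum_take ?psum0; lia.
move=> ks; have e1 := psumS p k.-1; rewrite prednK ?kp in e1; last lia.
(* A horizontal step at height 1 would make k+1 admissible. *)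
have hk0 : nth 0%R p k.-1 <> 0%R.
  move=> e0; apply: (kmax' k.+1); first lia.
    move=> j hj; case: (j =P k.-1) => [->|hjk]; first by rewrite kp.
    by apply: kn; lia.
  by rewrite /= e1 e0; lia.
have hs1 := wlab_step k.-1 hw.
split=> //; apply: size_le_posp => j; rewrite size_drop => hj.
rewrite psum_drop; last lia.
have [e|e] : nth 0%R p k.-1 = (-1)%R \/ nth 0%R p k.-1 = 1%R by lia.
  by have := pp (k + j); lia.
(* Remaining case of an up step: a first return to height 1 at position i would make i+1 admissible,
   against the maximality of k. *)
suff : forall i, k <= i <= size p -> (2 <= psum p i)%R.
  by move=> /(_ (k + j) ltac:(lia)); lia.
move=> i; elim/ltn_ind: i => i IH hi.
case: (i =P k) => [->|ik]; first lia.
have h2 := IH i.-1 ltac:(lia) ltac:(lia).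
have h3 := psumS p i.-1; rewrite prednK in h3; last lia.
have h4 := wlab_step i.-1 hw.
suff : psum p i <> 1%R by lia.
apply: (kmax' i.+1); first lia.
move=> l hl; case: (ltnP l k.-1) => h5; first by apply: kn; lia.
case: (l =P k.-1) => [->|h6]; first lia.
have := IH l ltac:(lia) ltac:(lia); lia.
Qed.

(** No later position is admissible, for a reason that depends on the sign of [x]: after -1 the walk
    has touched 0, which spoils the height condition of later candidates; after +1 it stays at
    height 2 or more and never meets 1 again. *)
Lemma last_k_join (p1 : seq int) (x : int) (p2 : seq int) : motz p1 -> posp p2 -> x <> 0%R -> (-1 <= x <= 1)%R ->
  last_k (negrev p1 ++ x :: p2) (size p1 + size p2).+2 = (size p1).+1.
Proof.
move=> [h0 h1 h2] hp x0 xb; apply: last_kE; first lia.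
- move=> j hj; rewrite psum_cat psum_negrev h2 size_negrev.
  have -> : j - size p1 = 0 by lia.
  rewrite psum0; have := h1 (size p1 - j) ltac:(lia); lia.
- rewrite psum_cat psum_negrev h2 size_negrev /= subnn !psum0; lia.
move=> i hi; rewrite psum_cat psum_negrev h2 size_negrev.
have -> : size p1 - i.-1 = 0 by lia.
have -> : i.-1 - size p1 = (i.-1 - size p1).-1.+1 by lia.
rewrite psum0 psum_cons => e2; have := hp (i.-1 - size p1).-1 => hp1.
have [e3|e3] : x = (-1)%R \/ x = 1%R by lia.
  exists (size p1).+1; last first.
    rewrite psum_cat psum_negrev h2 size_negrev subSn // subnn psum_cons psum0.
    have -> : size p1 - (size p1).+1 = 0 by lia.
    rewrite psum0; lia.
  (* The witness has height 0 whereas position i-1 has height 1, so the two positions differ. *)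
  suff : (i.-1 - size p1).-1 <> 0 by lia.
  by move=> e4; move: e2; rewrite e4 psum0; lia.
lia.
Qed.

Lemma last_k_negrev p : motz p -> last_k (negrev p) (size p).+1 = (size p).+1.
Proof.
move=> [h0 h1 h2]; apply: last_kE; first lia.
- move=> j hj; rewrite psum_negrev h2.
  have := h1 (size p - j) ltac:(lia); lia.
- rewrite psum_negrev h2 /= subnn !psum0; lia.
by move=> i hi; lia.
Qed.

Lemma posp_negrev p : motz p -> posp (negrev p).
Proof.
move=> [h0 h1 h2] j; rewrite psum_negrev h2.
case: (posnP j) => [->|hj]; first by rewrite subn0 h2.
have := h1 (size p - j) ltac:(lia); lia.
Qed.

Lemma posp_join (p1 : seq int) (x : int) (p2 : seq int) : motz p1 -> posp p2 -> (-1 <= x <= 1)%R ->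
  posp (negrev p1 ++ x :: p2).
Proof.
move=> [h0 h1 h2] hp xb j; rewrite psum_cat psum_negrev h2 size_negrev.
case: (posnP j) => [->|j0]; first by rewrite subn0 sub0n psum0 h2.
case: (leqP j (size p1)) => hj.
  have -> : j - size p1 = 0 by lia.
  rewrite psum0; have := h1 (size p1 - j) ltac:(lia); lia.
have -> : j - size p1 = (j - size p1).-1.+1 by lia.
have -> : size p1 - j = 0 by lia.
rewrite psum0 psum_cons; have := hp (j - size p1).-1; lia.
Qed.

Lemma posp_cons0 p : posp p -> posp (0%R :: p).
Proof. by move=> h [|j]; rewrite ?psum0 // psum_cons add0r. Qed.

Lemma posp_behead p : posp p -> head 0%R p = 0%R -> posp (behead p).
Proof.
case: p => [|x p] //= h e j; have := h j.+1.
by rewrite psum_cons e add0r.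
Qed.

(** * Trees up to the order of children, and the decomposition of paths *)

Lemma lam_invK (I : seq nat) x : x \in I -> lam I (lam_inv I x) = x.
Proof. by move=> h; rewrite /lam /lam_inv /= nth_index // mem_sort. Qed.

Lemma lam_inv_homo (I : seq nat) : {in I &, {homo lam_inv I : x y / x < y}}.
Proof.
move=> x y hx hy xy; rewrite /lam_inv ltnS ltnNge; apply/negP => h.
have srt : sorted leq (sort leq I) by apply: sort_sorted; exact: leq_total.
have [e|ne] := eqVneq (index y (sort leq I)) (index x (sort leq I)).
  suff : x = y by lia.
  by rewrite -(lam_invK hx) -(lam_invK hy) /lam_inv e.
have := sorted_ltn_index leq_trans srt y x.
by rewrite !mem_sort => /(_ hy hx); lia.
Qed.

Lemma perm_lam_inv (I s : seq nat) : uniq I -> perm_eq s I ->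
  perm_eq (map (lam_inv I) s) (iota 1 (size I)).
Proof.
move=> uI hs; apply: perm_trans (perm_map _ hs) _.
apply: (perm_trans (y := map (lam_inv I) (sort leq I))).
  by apply: perm_map; rewrite perm_sym perm_sort.
rewrite -(size_sort leq I) (_ : map _ _ = iota 1 (size (sort leq I))) //.
apply: (@eq_from_nth _ 0); first by rewrite size_map size_iota.
move=> i; rewrite size_map => hi; rewrite (nth_map 0) // nth_iota //.
by rewrite /lam_inv index_uniq ?sort_uniq.
Qed.

Lemma lam_homo (I : seq nat) : uniq I ->
  {in iota 1 (size I) &, {homo lam I : x y / x < y}}.
Proof.
move=> uI x y; rewrite !mem_iota /lam => hx hy xy.
have srt : sorted ltn (sort leq I).
  by rewrite ltn_sorted_uniq_leq sort_uniq uI sort_sorted //; exact: leq_total.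
by apply: (sorted_ltn_nth ltn_trans 0 srt); rewrite ?inE ?size_sort; lia.
Qed.

Lemma lam_mem (I : seq nat) x : x \in iota 1 (size I) -> lam I x \in I.
Proof.
rewrite mem_iota => hx; have h : x.-1 < size I by lia.
by rewrite /lam -(mem_sort leq) mem_nth ?size_sort.
Qed.

(** For a cut at k = n the definition standardises the labels but does not relabel afterwards; this
    is harmless because standardising [[n]] is the identity. *)
Lemma lam_inv_iota n (I : seq nat) x : perm_eq I (iota 1 n) -> x \in I -> lam_inv I x = x.
Proof.
move=> hI hx; rewrite /lam_inv.
have -> : sort leq I = iota 1 n.
  apply: (sorted_eq leq_trans anti_leq); rewrite ?perm_sort //.
    by apply: sort_sorted; exact: leq_total.
  exact: iota_sorted.
have := hx; rewrite (perm_mem hI) mem_iota => hb.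
have hx1 : x.-1 < n by lia.
have -> : index x (iota 1 n) = index (nth 0 (iota 1 n) x.-1) (iota 1 n).
  by rewrite nth_iota //; congr index; lia.
by rewrite index_uniq ?iota_uniq ?size_iota //; lia.
Qed.

(** The last clause carries an arbitrary [g] because an outer relabelling is still pending when the
    recursion reaches a piece. *)
Lemma standardise (I : seq nat) (p : seq int) (s : seq nat) : uniq I -> perm_eq s I -> wlab p s ->
  [/\ wlab p (map (lam_inv I) s),
      perm_eq (map (lam_inv I) s) (iota 1 (size (map (lam_inv I) s)))
    & forall T (g : nat -> T), map (g \o lam I) (map (lam_inv I) s) = map g s].
Proof.
move=> uI hs hw; split.
- apply: wlab_map => // x y; rewrite !(perm_mem hs); exact: lam_inv_homo.
- by rewrite size_map (perm_size hs) perm_lam_inv.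
move=> T g; rewrite -map_comp; apply/eq_in_map => x; rewrite (perm_mem hs) => hx /=.
by rewrite lam_invK.
Qed.

Lemma relabel_comp f g t : relabel f (relabel g t) = relabel (f \o g) t.
Proof. by elim: t => //= m l -> r ->. Qed.

Lemma relabel_id t : relabel id t = t.
Proof. by elim: t => //= m l -> r ->. Qed.

Lemma relabel_mark_root f t : relabel f (mark_root t) = mark_root (relabel f t).
Proof. by case: t. Qed.

(** * Invariance under the canonical ordering of the children *)

Lemma leaves_canon t : perm_eq (leaves (canon t)) (leaves t).
Proof.
elim: t => //= m l hl r hr; case: ifP => _ /=; first exact: perm_cat.
by rewrite perm_catC perm_cat.
Qed.

Lemma minleaf_canon t : minleaf (canon t) = minleaf t.
Proof. by elim: t => //= m l hl r hr; case: ifP => _ /=; rewrite hl hr // minnC. Qed.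

Lemma minleaf_mem t : minleaf t \in leaves t.
Proof.
elim: t => [m x|m l hl r hr] /=; first by rewrite inE.
by rewrite mem_cat /minn; case: ifP; rewrite ?hl ?hr ?orbT.
Qed.

Lemma is_node_canon t : is_node (canon t) = is_node t.
Proof. by case: t => //= m l r; case: ifP. Qed.

Lemma root_mark_canon t : root_mark (canon t) = root_mark t.
Proof. by case: t => //= m l r; case: ifP. Qed.

Lemma nmarks_canon t : nmarks (canon t) = nmarks t.
Proof. by elim: t => //= m l hl r hr; case: ifP => _ /=; rewrite hl hr // addnAC. Qed.

Lemma is_qs_canon x y : is_qs (canon x) (canon y) = is_qs x y.
Proof.
case: x => [m a|m l r] /=; first by rewrite is_node_canon root_mark_canon.
by case: ifP.
Qed.

Lemma nqs_canon t : nqs (canon t) = nqs t.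
Proof.
elim: t => //= m l hl r hr; rewrite -(is_qs_canon l r) -(is_qs_canon r l).
case: ifP => _ /=; rewrite hl hr //.
by rewrite -!addnA addnCA; congr (_ + (_ + _)); rewrite addnC.
Qed.

Lemma minleaf_neq l r : uniq (leaves l ++ leaves r) -> minleaf l != minleaf r.
Proof.
rewrite cat_uniq => /and3P[_ /hasPn h _]; apply/eqP => e.
by have := h _ (minleaf_mem r); rewrite -e minleaf_mem.
Qed.

Lemma is_canon_canon t : uniq (leaves t) -> is_canon (canon t).
Proof.
elim: t => //= m l hl r hr u; have ne := minleaf_neq u.
have := u; rewrite cat_uniq => /and3P[/hl hl' _ /hr hr'].
by rewrite !minleaf_canon; case: ifP => h /=; rewrite !minleaf_canon hl' hr' !andbT; lia.
Qed.

Lemma canon_id t : is_canon t -> canon t = t.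
Proof.
by elim: t => //= m l hl r hr /and3P[h /hl -> /hr ->]; rewrite (ltnW h).
Qed.

Lemma canonC m l r : uniq (leaves l ++ leaves r) ->
  canon (BNode m l r) = canon (BNode m r l).
Proof.
move=> /minleaf_neq; rewrite /= !minleaf_canon.
by case: (ltngtP (minleaf l) (minleaf r)).
Qed.

Lemma canon_canon t : uniq (leaves t) -> canon (canon t) = canon t.
Proof. by move=> /is_canon_canon /canon_id. Qed.

Lemma minleaf_relabel g t : {in leaves t &, {homo g : x y / x < y}} ->
  minleaf (relabel g t) = g (minleaf t).
Proof.
elim: t => //= m l hl r hr hg.
have hl' : minleaf (relabel g l) = g (minleaf l).
  by apply: hl => x y hx hy; apply: hg; rewrite mem_cat ?hx ?hy.
have hr' : minleaf (relabel g r) = g (minleaf r).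
  by apply: hr => x y hx hy; apply: hg; rewrite mem_cat ?hx ?hy orbT.
have ml : minleaf l \in leaves l ++ leaves r by rewrite mem_cat minleaf_mem.
have mr : minleaf r \in leaves l ++ leaves r by rewrite mem_cat minleaf_mem orbT.
rewrite hl' hr'; case: (ltngtP (minleaf l) (minleaf r)) => h.
- by apply/minn_idPl/ltnW/hg.
- by apply/minn_idPr/ltnW/hg.
by rewrite h minnn.
Qed.

(** The order of the children depends only on comparisons between least labels, which an increasing
    map preserves. *)
Lemma canon_relabel g t : {in leaves t &, {homo g : x y / x < y}} ->
  canon (relabel g t) = relabel g (canon t).
Proof.
elim: t => //= m l hl r hr hg.
have gl : {in leaves l &, {homo g : x y / x < y}}.
  by move=> x y hx hy; apply: hg; rewrite mem_cat ?hx ?hy.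
have gr : {in leaves r &, {homo g : x y / x < y}}.
  by move=> x y hx hy; apply: hg; rewrite mem_cat ?hx ?hy orbT.
rewrite !minleaf_canon !minleaf_relabel // hl // hr //.
have ml : minleaf l \in leaves l ++ leaves r by rewrite mem_cat minleaf_mem.
have mr : minleaf r \in leaves l ++ leaves r by rewrite mem_cat minleaf_mem orbT.
case: (ltngtP (minleaf l) (minleaf r)) => h.
- by rewrite (ltnW (hg _ _ ml mr h)).
- by have := hg _ _ mr ml h; rewrite ltnNge => /negbTE ->.
by rewrite h leqnn.
Qed.

Lemma canon_mark_root t : canon (mark_root t) = mark_root (canon t).
Proof. by case: t => //= m l r; case: ifP. Qed.

Lemma canon_congr m l r l' r' : canon l = canon l' -> canon r = canon r' ->
  canon (BNode m l r) = canon (BNode m l' r').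
Proof. by move=> /= -> ->. Qed.

Lemma leaves_mark_root t : leaves (mark_root t) = leaves t.
Proof. by case: t. Qed.

Lemma size_leaves_node t : is_node t -> 1 < size (leaves t).
Proof.
have ne u : 0 < size (leaves u) by elim: u => //= m l hl r hr; rewrite size_cat; lia.
by case: t => //= m l r _; rewrite size_cat; have := ne l; have := ne r; lia.
Qed.

Lemma horizontal_cat p q :
  horizontal_steps (p ++ q) = horizontal_steps p + horizontal_steps q.
Proof. exact: count_cat. Qed.

Lemma horizontal_negrev p : horizontal_steps (negrev p) = horizontal_steps p.
Proof.
rewrite /horizontal_steps /negrev count_map -[RHS]count_rev.
by apply: eq_count => x /=; rewrite oppr_eq0.
Qed.

(* Phi_f and Phi'_f without the standardisation of labels at each step. *)
Fixpoint tree_of_path (fuel : nat) (p : seq int) (s : seq nat) : btree :=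
  match fuel with
  | 0 => BLeaf false 0
  | fuel'.+1 =>
    if size s <= 2 then BNode false (BLeaf false (nth 0 s 0)) (BLeaf false (nth 0 s 1))
    else if head 0%R p == 0%R then
      BNode false (BLeaf false (head 0 s)) (tree_of_path fuel' (behead p) (behead s))
    else if head 0%R p == 1%R then
      let k := first_zero p in
      BNode false (tree_of_path fuel' (negrev (take k.-1 p)) (rev (take k s)))
                  (tree_of_path fuel' (drop k p) (drop k s))
    else BLeaf false 0
  end.

Fixpoint mtree_of_path (fuel : nat) (p : seq int) (s : seq nat) : btree :=
  match fuel with
  | 0 => BLeaf true 0
  | fuel'.+1 =>
    if size s <= 1 then BLeaf true (head 0 s)
    else if head 0%R p == 0%R then
      BNode false (BLeaf false (head 0 s)) (mtree_of_path fuel' (behead p) (behead s))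
    else if head 0%R p == 1%R then
      let k := last_k p (size s) in
      let u := canon (tree_of_path k (negrev (take k.-1 p)) (rev (take k s))) in
      if k == size s then mark_root u
      else BNode false u (mtree_of_path fuel' (drop k p) (drop k s))
    else BLeaf true 0
  end.

(** * The inverse maps, from trees to paths *)

Definition hstep (a : nat) (P : seq int * seq nat) : seq int * seq nat :=
  (0%R :: P.1, a :: P.2).
(** Reversing [P] undoes the reversal made by the cut, so the step [x] links the first labels of the
    two pieces. *)
Definition join (x : int) (P Q : seq int * seq nat) : seq int * seq nat :=
  (negrev P.1 ++ x :: Q.1, rev P.2 ++ Q.2).

(** Two leaves fall under the same clause as two internal vertices: joining two one-point paths by
    -1 gives the path of size 2. Only the mixed case comes from a horizontal step. *)
Fixpoint path_of_tree (t : btree) : seq int * seq nat :=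
  match t with
  | BLeaf _ a => ([::], [:: a])
  | BNode _ l r =>
    let P := path_of_tree l in let Q := path_of_tree r in
    if is_node l (+) is_node r then
      if is_node l then hstep (minleaf r) P else hstep (minleaf l) Q
    else if head 0 P.2 < head 0 Q.2 then join (-1)%R P Q else join (-1)%R Q P
  end.

Definition attach (u : btree) (Q : seq int * seq nat) : seq int * seq nat :=
  let P := path_of_tree u in
  if is_node u then join (if head 0 P.2 < head 0 Q.2 then (-1)%R else 1%R) P Q
  else hstep (minleaf u) Q.

(** A marked internal root records a cut at k = n, where the whole path is a reversed Motzkin path.
    Otherwise the child without a mark is the first piece. *)
Fixpoint path_of_mtree (t : btree) : seq int * seq nat :=
  match t with
  | BLeaf _ a => ([::], [:: a])
  | BNode m l r =>
    if m then let P := path_of_tree t in (negrev P.1, rev P.2)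
    else if nmarks l == 0 then attach l (path_of_mtree r)
    else attach r (path_of_mtree l)
  end.

Lemma uniq_pieces k (s : seq nat) : uniq s ->
  [/\ uniq (take k s), uniq (drop k s), uniq (rev (take k s)) &
      forall u v, perm_eq u (rev (take k s)) -> perm_eq v (drop k s) ->
      perm_eq (u ++ v) s].
Proof.
rewrite -{1}(cat_take_drop k s) cat_uniq => /and3P[h1 _ h2].
split=> //; first by rewrite rev_uniq.
move=> u v hu hv; rewrite -[X in perm_eq _ X](cat_take_drop k s).
by apply: perm_cat => //; apply: perm_trans hu _; rewrite perm_rev.
Qed.

Lemma motz_size2 p s : motz p -> wlab p s -> size s <= 2 ->
  p = [:: (-1)%R] /\ exists a b, s = [:: a; b] /\ a < b.
Proof.
move=> [h0 h1 h2] hw hs; have sz := wlab_size hw.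
case: p h0 h1 h2 hw sz => [|x [|y p]] //= _ _; last by lia.
case: s hs => [|a [|b [|c s]]] //= _ e hw _.
have ex : x = (-1)%R by move: e; rewrite psum_cons psum_nil addr0.
by move: hw; rewrite ex /step_ok /= andbT orbF => hab; split=> //; exists a, b.
Qed.

(** The pending relabelling [g] is generalised: each recursive call composes it with one more [lam],
    which cancels the standardisation made at that call. *)
Lemma Phi_fE fuel (p : seq int) s (g : nat -> nat) : motz p -> wlab p s ->
  perm_eq s (iota 1 (size s)) -> size s <= fuel ->
  relabel g (Phi_f fuel p s) = tree_of_path fuel p (map g s).
Proof.
elim: fuel p s g => [|fuel IH] p s g mp hw hs hf.
  by have := wlab_size hw; lia.
have us : uniq s by rewrite (perm_uniq hs) iota_uniq.
rewrite /= size_map; case: ifP => h2.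
  have [_ [a [b [e ab]]]] := motz_size2 mp hw h2.
  move: hs; rewrite e /= => hs.
  have ha : a \in [:: 1; 2] by rewrite -(perm_mem hs) inE eqxx.
  have hb : b \in [:: 1; 2] by rewrite -(perm_mem hs) !inE eqxx orbT.
  by move: ha hb; rewrite !inE => /orP[/eqP ea|/eqP ea] /orP[/eqP eb|/eqP eb]; subst.
case: ifP => [/eqP h0|/eqP h0].
  have sp : 0 < size p by case: mp.
  case: p s mp hw hs us hf h0 {h2} sp => [|x p] [|a s] mp //= /andP[_ hw] hs us hf h0 _.
  set I := [seq y <- iota 1 (size s).+1 | y != a].
  have hI : perm_eq s I.
    apply: uniq_perm; [by case/andP: us | exact: filter_uniq (iota_uniq _ _) |].
    move=> y; rewrite mem_filter -(perm_mem hs) inE.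
    by case: eqP => [->|//]; case/andP: us => /negbTE ->.
  have uI : uniq I by exact: filter_uniq (iota_uniq _ _).
  have [w1 w2 w3] := standardise uI hI hw.
  rewrite relabel_comp IH ?w3 //; first exact: (motz_behead mp h0).
  by rewrite size_map.
have [hd [k1 k2] hk m1 m2] := motz_split mp hw ltac:(lia) h0.
rewrite hd eqxx /=; set k := first_zero p in k1 k2 hk m1 m2 *; clearbody k.
have [_ /and3P[wa _ wb]] := wlab_split hw (k := k) ltac:(lia) ltac:(lia).
have [u1 u2 u3 _] := uniq_pieces k us.
have pr : perm_eq (rev (take k s)) (take k s) by rewrite perm_rev.
have [w1 w2 w3] := standardise u1 pr (wlab_negrev wa).
have [z1 z2 z3] := standardise u2 (perm_refl _) wb.
have szt : size (take k s) = k by rewrite size_takel //; clear -k2; lia.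
rewrite !relabel_comp (IH _ _ _ m1 w1 w2) ?(IH _ _ _ m2 z1 z2) ?w3 ?z3;
  try by rewrite !size_map ?size_rev ?szt ?size_drop; clear -hf k1 k2; lia.
by rewrite map_rev map_take map_drop.
Qed.

Lemma is_qs_node u v : is_node u -> is_qs u v = false.
Proof. by case: u. Qed.

Lemma last_take_rev k (s : seq nat) : head 0 (rev (take k s)) = last 0 (take k s).
Proof. by elim/last_ind: (take k s) => // u x _; rewrite rev_rcons last_rcons. Qed.

(** A horizontal step hangs a leaf beside an internal vertex, hence one quasi-single leaf; a cut
    creates two internal children and the path of size 2 creates two sibling leaves, hence none. The
    induction carries [is_node t] for the sake of this count. *)
Lemma tree_of_path_spec fuel (p : seq int) (s : seq nat) :
  motz p -> wlab p s -> uniq s -> size s <= fuel ->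
  let t := tree_of_path fuel p s in
  [/\ path_of_tree t = (p, s), perm_eq (leaves t) s, nmarks t = 0, is_node t
    & nqs t = horizontal_steps p].
Proof.
elim: fuel p s => [|fuel IH] p s mp hw us hf.
  by have := wlab_size hw; lia.
rewrite /=; case: ifP => h2.
  by have [-> [a [b [-> ab]]]] := motz_size2 mp hw h2; rewrite /= ab.
case: ifP => [/eqP h0|/eqP h0].
  have sp : 0 < size p by case: mp.
  case: p s mp hw us hf h0 {h2} sp => [|x p] [|a s] mp //=.
  move=> /andP[_ hw] /andP[ua us] hf h0 _; have := motz_behead mp h0 => /= mp'.
  have [e1 e2 e3 e4 e5] := IH p s mp' hw us hf.
  rewrite e1 e3 e4 e5 (is_qs_node _ e4) /= /hstep /= h0; split=> //.
    by rewrite perm_cons.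
  by rewrite orbT /horizontal_steps /= addn0.
have [hd [k1 k2] hk m1 m2] := motz_split mp hw ltac:(lia) h0.
rewrite hd eqxx /=; set k := first_zero p in k1 k2 hk m1 m2 *; clearbody k.
have [ep /and3P[wa st wb]] := wlab_split hw (k := k) ltac:(lia) ltac:(lia).
have [u1 u2 u3 hp] := uniq_pieces k us.
have [|e1 e2 e3 e4 e5] := IH _ _ m1 (wlab_negrev wa) u3.
  by rewrite size_rev size_takel; clear -hf k1 k2; lia.
have [|d1 d2 d3 d4 d5] := IH _ _ m2 wb u2.
  by rewrite size_drop; clear -hf k1 k2; lia.
(* The removed step is -1, so the first label of the reversed first piece is below that of the
   second piece, and [path_of_tree] joins them in the original order. *)
rewrite e1 d1 e3 d3 e4 d4 e5 d5 !is_qs_node //= last_take_rev.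
move: st; rewrite /step_ok hk /= orbF => ->.
rewrite /join /= negrevK revK cat_take_drop -hk -ep; split=> //; first exact: hp.
by rewrite [in RHS]ep horizontal_negrev horizontal_cat /horizontal_steps /= hk.
Qed.

Lemma relabel_Phi g (p : seq int) (s : seq nat) : motz p -> wlab p s ->
  perm_eq s (iota 1 (size s)) -> {in s &, {homo g : x y / x < y}} ->
  relabel g (Phi p s) = canon (tree_of_path (size s) p (map g s)).
Proof.
move=> mp hw hs hg; have us : uniq s by rewrite (perm_uniq hs) iota_uniq.
rewrite /Phi -Phi_fE // -canon_relabel // -(relabel_id (Phi_f _ _ _)) Phi_fE //.
rewrite map_id; have [_ hl _ _ _] := tree_of_path_spec mp hw us (leqnn _).
by move=> x y; rewrite !(perm_mem hl); apply: hg.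
Qed.

(** Here [g] is taken increasing because the calls to [Phi] hide a [canon], through which the
    relabelling has to be moved. *)
Lemma Phi'_fE fuel (p : seq int) (s : seq nat) (g : nat -> nat) :
  posp p -> wlab p s ->
  perm_eq s (iota 1 (size s)) -> size s <= fuel ->
  {in s &, {homo g : x y / x < y}} ->
  relabel g (Phi'_f fuel p s) = mtree_of_path fuel p (map g s).
Proof.
elim: fuel p s g => [|fuel IH] p s g pp hw hs hf hg.
  by have := wlab_size hw; lia.
have us : uniq s by rewrite (perm_uniq hs) iota_uniq.
rewrite /= size_map; case: ifP => h2.
  have := wlab_size hw; case: s hs h2 {hw hf us hg} => [|a [|b s]] //= hs _ _.
  by have : a \in [:: 1] by [rewrite -(perm_mem hs) inE]; rewrite inE => /eqP ->.
case: ifP => [/eqP h0|/eqP h0].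
  have sp : 0 < size p by have := wlab_size hw; lia.
  case: p s pp hw hs us hf h0 {h2} sp hg => [|x p] [|a s] pp //= /andP[_ hw] hs us hf h0 _ hg.
  set I := [seq y <- iota 1 (size s).+1 | y != a].
  have hI : perm_eq s I.
    apply: uniq_perm; [by case/andP: us | exact: filter_uniq (iota_uniq _ _) |].
    move=> y; rewrite mem_filter -(perm_mem hs) inE.
    by case: eqP => [->|//]; case/andP: us => /negbTE ->.
  have uI : uniq I by exact: filter_uniq (iota_uniq _ _).
  have [w1 w2 w3] := standardise uI hI hw.
  rewrite relabel_comp (IH p _ _ (posp_behead pp h0) w1 w2) ?size_map ?w3 //; have w2' := perm_lam_inv uI hI.
  move=> y z; rewrite !(perm_mem w2') => hy hz yz; change (g (lam I y) < g (lam I z)).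
  apply: hg; last exact: (lam_homo uI).
    by rewrite inE (perm_mem hI) lam_mem ?orbT.
  by rewrite inE (perm_mem hI) lam_mem ?orbT.
have [hd k1 m1 m2] := posp_split pp hw ltac:(lia) h0.
rewrite hd eqxx /=; set k := last_k p (size s) in k1 m1 m2 *; clearbody k.
have szt : size (take k s) = k by rewrite size_takel //; lia.
case: ifP => [/eqP ks|/eqP kns].
  have et : take k s = s by rewrite ks take_size.
  have ep : take k.-1 p = p by rewrite take_oversize //; have := wlab_size hw; lia.
  rewrite -map_take et; have -> : [seq lam_inv s i | i <- rev s] = rev s.
    by apply: map_id_in => x; rewrite mem_rev; apply: lam_inv_iota hs.
  rewrite relabel_mark_root relabel_Phi.
  - by rewrite -/(negrev _) map_rev size_rev -ks.
  - exact: m1.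
  - by have := wlab_negrev hw; rewrite ep.
  - by rewrite perm_rev size_rev.
  by move=> x y; rewrite !mem_rev; apply: hg.
have [m3 _] := m2 ltac:(lia).
have [_ /and3P[wa _ wb]] := wlab_split hw (k := k) ltac:(lia) ltac:(lia).
have [u1 u2 u3 _] := uniq_pieces k us.
have pr : perm_eq (rev (take k s)) (take k s) by rewrite perm_rev.
have [w1 w2 w3] := standardise u1 pr (wlab_negrev wa).
have [z1 z2 z3] := standardise u2 (perm_refl _) wb.
rewrite /= !relabel_comp (IH _ _ _ m3 z1 z2) ?(relabel_Phi m1 w1 w2) ?w3 ?z3.
- by rewrite !size_map size_rev szt map_rev map_take map_drop.
- move=> x y; rewrite !(perm_mem w2) size_map size_rev => hx hy xy /=.
  by apply: hg; rewrite ?(mem_take (lam_mem _)) //; exact: (lam_homo u1).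
- by rewrite size_map size_drop; clear -hf k1; lia.
move=> x y; rewrite !(perm_mem z2) size_map => hx hy xy /=.
by apply: hg; rewrite ?(mem_drop (lam_mem _)) //; exact: (lam_homo u2).
Qed.

Lemma head_mem (s : seq nat) : s != [::] -> head 0 s \in s.
Proof. by case: s => //= a s; rewrite inE eqxx. Qed.

Lemma last_rev_head (s : seq nat) : last 0 (rev s) = head 0 s.
Proof. by case: s => //= a s; rewrite rev_cons last_rcons. Qed.

Lemma path_of_tree_perm t : perm_eq (path_of_tree t).2 (leaves t).
Proof.
elim: t => //= m l hl r hr; case: ifP => [|_].
  case: l hl => [ml a|ml l1 l2] hl; case: r hr => [mr b|mr r1 r2] hr //= _.
    by rewrite perm_cons.
  by rewrite perm_sym perm_catC perm_sym perm_cons.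
case: ifP => _ /=.
  by apply: perm_cat => //; rewrite perm_rev.
by rewrite perm_sym perm_catC perm_sym; apply: perm_cat => //; rewrite perm_rev.
Qed.

Lemma path_of_tree_nonempty t : (path_of_tree t).2 != [::].
Proof.
rewrite -size_eq0 (perm_size (path_of_tree_perm t)) size_eq0; apply/eqP => e.
by have := minleaf_mem t; rewrite e.
Qed.

Lemma path_of_tree_head t : head 0 (path_of_tree t).2 \in leaves t.
Proof. by rewrite -(perm_mem (path_of_tree_perm t)) head_mem // path_of_tree_nonempty. Qed.

Lemma path_head_neq l r : uniq (leaves l ++ leaves r) ->
  head 0 (path_of_tree l).2 != head 0 (path_of_tree r).2.
Proof.
rewrite cat_uniq => /and3P[_ /hasPn h _]; apply/eqP => e.
by have := h _ (path_of_tree_head r); rewrite -e path_of_tree_head.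
Qed.

Lemma path_of_treeC m l r : uniq (leaves l ++ leaves r) ->
  path_of_tree (BNode m l r) = path_of_tree (BNode m r l).
Proof.
move=> /path_head_neq; rewrite /= [in RHS]addbC.
case: ifP => [|_]; first by case: (is_node l); case: (is_node r).
by case: ltngtP.
Qed.

Lemma path_of_tree_canon t : uniq (leaves t) -> path_of_tree (canon t) = path_of_tree t.
Proof.
elim: t => // m l hl r hr u; have := u; rewrite /= cat_uniq => /and3P[/hl hl' _ /hr hr'].
have e : path_of_tree (BNode m (canon l) (canon r)) = path_of_tree (BNode m l r).
  by rewrite /= hl' hr' !is_node_canon !minleaf_canon.
rewrite -[RHS]/(path_of_tree (BNode m l r)) -e; case: ifP => // _.
apply: path_of_treeC; rewrite uniq_catC.
by rewrite (perm_uniq (perm_cat (leaves_canon l) (leaves_canon r))).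
Qed.

Lemma wlab_join x P Q : wlab P.1 P.2 -> wlab Q.1 Q.2 ->
  step_ok x (head 0 P.2) (head 0 Q.2) ->
  wlab (join x P Q).1 (join x P Q).2.
Proof.
move=> hP hQ hs; rewrite wlab_cat; last by rewrite size_rev size_negrev (wlab_size hP).
by rewrite wlab_negrev //= hQ last_rev_head hs.
Qed.

Lemma path_of_tree_wlab t : uniq (leaves t) ->
  wlab (path_of_tree t).1 (path_of_tree t).2 /\
  (is_node t -> motz (path_of_tree t).1).
Proof.
elim: t => // m l hl r hr u; have := u; rewrite /= cat_uniq => /and3P[/hl[w1 m1] _ /hr[w2 m2]].
have ne := path_head_neq u; case: ifP => [|h].
  case: (is_node l) m1; case: (is_node r) m2 => //= m2 m1 _.
    by split=> // _; apply: motz0; exact: m1.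
  by split=> // _; apply: motz0; exact: m2.
split.
  by case: ifP => lt; apply: wlab_join => //; rewrite /step_ok eqxx /=; lia.
move=> _; case: l m1 h {u w1 ne hl} => [ml a|ml l1 l2] m1.
  case: r m2 {w2 hr} => [mr b|//] m2 _ /=.
  by case: ifP => _ /=; split=> //= -[].
case: r m2 {w2 hr} => [//|mr r1 r2] m2 _.
by case: ifP => _; apply: motz_join; first [exact: m1 | exact: m2].
Qed.

Lemma tree_of_path_join fuel P Q : motz P.1 -> wlab P.1 P.2 -> motz Q.1 ->
  wlab Q.1 Q.2 ->
  tree_of_path fuel.+1 (join (-1)%R P Q).1 (join (-1)%R P Q).2 =
  BNode false (tree_of_path fuel P.1 P.2) (tree_of_path fuel Q.1 Q.2).
Proof.
case: P Q => [p1 s1] [p2 s2] /=; move=> mp1 w1 mp2 w2; rewrite /= first_zero_join // /=.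
have z1 := wlab_size w1; have z2 := wlab_size w2.
have g1 : 0 < size p1 by case: mp1.
have g2 : 0 < size p2 by case: mp2.
(* The first letter of the reversed word is the opposite of the last letter of [p1], which takes a
   nonnegative height down to -1. *)
have hd : head 0%R (negrev p1 ++ (-1)%R :: p2) = 1%R.
  have <- : head 0%R (negrev p1) = head 0%R (negrev p1 ++ (-1)%R :: p2).
    by move: (size_negrev p1) g1; case: (negrev p1) => //= <-.
  have := wlab_step 0 (wlab_negrev w1); rewrite nth0.
  rewrite head_psum1 psum_negrev; case: mp1 => _ h ->.
  by have := h (size p1 - 1) ltac:(lia); lia.
rewrite hd /= size_cat size_rev; case: ifP => [|_]; first lia.
rewrite -[size p1](size_negrev p1) take_size_cat // negrevK drop_cat size_negrev.
rewrite ltnNge leqnSn /= subSn // subnn /= drop0.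
by rewrite -z1 -(size_rev s1) take_size_cat // drop_size_cat // revK.
Qed.

(** The comparison is made after [canon] because a join orders the two pieces by their first labels,
    whereas the canonical form orders the subtrees by their least labels. *)
Lemma tree_of_pathK fuel t : uniq (leaves t) -> nmarks t = 0 -> is_node t ->
  size (leaves t) <= fuel ->
  canon (tree_of_path fuel (path_of_tree t).1 (path_of_tree t).2) = canon t.
Proof.
elim: t fuel => // m l hl r hr [|fuel] u; first by have := @size_leaves_node (BNode m l r) isT; lia.
rewrite [nmarks _]/=; case: m u => // u hm _; rewrite [leaves _]/= size_cat => hf.
have := u; rewrite [leaves _]/= cat_uniq => /and3P[ul _ ur].
have zl : 0 < size (leaves l) by have := minleaf_mem l; case: (leaves l).
have zr : 0 < size (leaves r) by have := minleaf_mem r; case: (leaves r).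
have [wl ml] := path_of_tree_wlab ul; have [wr mr] := path_of_tree_wlab ur.
have sl := perm_size (path_of_tree_perm l).
have sr := perm_size (path_of_tree_perm r).
have ne := path_head_neq u.
have pe : path_of_tree (BNode false l r) =
    let P := path_of_tree l in let Q := path_of_tree r in
    if is_node l (+) is_node r then
      if is_node l then hstep (minleaf r) P else hstep (minleaf l) Q
    else if head 0 P.2 < head 0 Q.2 then join (-1)%R P Q else join (-1)%R Q P by [].
rewrite pe {pe}; case il : (is_node l); case ir : (is_node r); cbv beta iota zeta delta [addb negb].
- have {}hl := hl fuel ul ltac:(lia) il ltac:(lia).
  have {}hr := hr fuel ur ltac:(lia) ir ltac:(lia).
  case: ifP => lt.
    rewrite tree_of_path_join //; [|exact: ml|exact: mr].
    exact: canon_congr.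
  rewrite tree_of_path_join //; [|exact: mr|exact: ml].
  by rewrite [RHS]canonC //; apply: canon_congr.
- have {}hl := hl fuel ul ltac:(lia) il ltac:(lia).
  rewrite [tree_of_path _ _ _]/=.
  have := size_leaves_node il; rewrite ltnNge -sl -ltnS => /negbTE -> /=.
  rewrite -[RHS]/(canon (BNode false l r)) [RHS]canonC //.
  rewrite -[LHS]/(canon (BNode false (BLeaf false (minleaf r))
    (tree_of_path fuel (path_of_tree l).1 (path_of_tree l).2))).
  by apply: canon_congr => //; case: r ir hm {u ur zr hf hr wr mr sr ne} => // -[] a _ //= hm; exfalso; lia.
- have {}hr := hr fuel ur ltac:(lia) ir ltac:(lia).
  rewrite [tree_of_path _ _ _]/=.
  have := size_leaves_node ir; rewrite ltnNge -sr -ltnS => /negbTE -> /=.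
  rewrite -[RHS]/(canon (BNode false l r)).
  rewrite -[LHS]/(canon (BNode false (BLeaf false (minleaf l))
    (tree_of_path fuel (path_of_tree r).1 (path_of_tree r).2))).
  by apply: canon_congr => //; case: l il hm {u ul zl hf hl wl ml sl ne} => // -[] a _ //= hm; exfalso; lia.
case: l il hm ne {u ul zl hf hl wl ml sl} => // -[//|] a _.
case: r ir {ur zr hr wr mr sr} => // -[//|] b _ _ /= ne.
have [h|h] : a < b \/ b < a by clear -ne; lia.
  by rewrite h /= (ltnW h).
by rewrite [a < b]ltnNge (ltnW h) /= (ltnW h) leqNgt h.
Qed.

(** * Marked trees and positive paths *)

Lemma mark_root_node t : is_node t -> nmarks t = 0 ->
  nmarks (mark_root t) = 1 /\ path_of_mtree (mark_root t) =
    (negrev (path_of_tree t).1, rev (path_of_tree t).2).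
Proof. by case: t => //= m l r _ h; split=> //; lia. Qed.

Lemma nqs_mark_root t : nqs (mark_root t) = nqs t.
Proof. by case: t. Qed.

Lemma root_mark_mark_root t : root_mark (mark_root t).
Proof. by case: t. Qed.

(** The clause [root_mark t || is_node t] serves the count twice: a leaf hung beside such a tree is
    quasi-single, and the tree itself, if it is a leaf, is marked and so is not. *)
Lemma mtree_of_path_spec fuel (p : seq int) (s : seq nat) :
  posp p -> wlab p s -> uniq s -> size s <= fuel ->
  let t := mtree_of_path fuel p s in
  [/\ path_of_mtree t = (p, s), perm_eq (leaves t) s, nmarks t = 1,
      root_mark t || is_node t & nqs t = horizontal_steps p].
Proof.
elim: fuel p s => [|fuel IH] p s mp hw us hf.
  by have := wlab_size hw; lia.
rewrite /=; case: ifP => h2.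
  have := wlab_size hw; case: p s hw h2 {mp us hf} => [|x p] [|a [|b s]] //=.
case: ifP => [/eqP h0|/eqP h0].
  have sp : 0 < size p by have := wlab_size hw; lia.
  case: p s mp hw us hf h0 {h2} sp => [|x p] [|a s] mp //=.
  move=> /andP[_ hw] /andP[ua us] hf h0 _; have := posp_behead mp h0 => /= mp'.
  have [e1 e2 e3 e4 e5] := IH p s mp' hw us hf.
  have e6 : is_qs (mtree_of_path fuel p s) (BLeaf false a) = false.
    by case: (mtree_of_path fuel p s) e4 => //= -[].
  rewrite e1 e3 e4 e5 e6 /attach /hstep /= h0; split=> //.
  by rewrite perm_cons.
have [hd k1 m1 m2] := posp_split mp hw ltac:(lia) h0.
rewrite hd eqxx /=; set k := last_k p (size s) in k1 m1 m2 *; clearbody k.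
have [u1 u2 u3 hp] := uniq_pieces k us.
have szt : size (take k s) = k by rewrite size_takel //; lia.
have wa : wlab (take k.-1 p) (take k s).
  have [e|e] : k = size s \/ k < size s by lia.
    by rewrite e take_size take_oversize //; have := wlab_size hw; lia.
  by have [_ /and3P[]] := wlab_split hw (k := k) ltac:(lia) ltac:(lia).
have [|e1 e2 e3 e4 e5] := tree_of_path_spec m1 (wlab_negrev wa) u3 (fuel := k).
  by rewrite size_rev szt.
set u := canon _.
have uq : uniq (leaves (tree_of_path k (negrev (take k.-1 p)) (rev (take k s)))).
  by rewrite (perm_uniq e2).
have f1 : path_of_tree u = (negrev (take k.-1 p), rev (take k s)).
  by rewrite /u path_of_tree_canon.
have f2 : perm_eq (leaves u) (rev (take k s)).
  exact: perm_trans (leaves_canon _) e2.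
have f3 : nmarks u = 0 by rewrite /u nmarks_canon.
have f4 : is_node u by rewrite /u is_node_canon.
have f5 : nqs u = horizontal_steps (negrev (take k.-1 p)) by rewrite /u nqs_canon.
case: ifP => [/eqP ks|/eqP kns].
  have et : take k s = s by rewrite ks take_size.
  have ep : take k.-1 p = p.
    by rewrite take_oversize //; have := wlab_size hw; clear -ks; lia.
  have [g1 g2] := mark_root_node f4 f3.
  rewrite g1 g2 f1 /= negrevK revK ep et nqs_mark_root f5 root_mark_mark_root.
  rewrite horizontal_negrev ?ep; split=> //; rewrite leaves_mark_root.
  by apply: perm_trans f2 _; rewrite perm_rev et.
have kp : 0 < k by case/andP: k1 => /ltnW.
have ks : k < size s by clear -k1 kns; lia.
have [m3 nk0] := m2 ks.
have [ep /and3P[_ st wb]] := wlab_split hw kp ks.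
have [|d1 d2 d3 d4 d5] := IH _ _ m3 wb u2.
  by rewrite size_drop; clear -hf k1; lia.
set v := mtree_of_path _ _ _ in d1 d2 d3 d4 d5 *.
rewrite /= f3 d3 d1 d5 f5 eqxx /attach f4 f1 (is_qs_node _ f4) /= last_take_rev.
have e6 : is_qs v u = false by case: (v) d3 d4 => //= -[].
have -> : (if last 0 (take k s) < head 0 (drop k s) then (-1)%R else 1%R) = nth 0%R p k.-1.
  move: st; rewrite /step_ok; case/or3P=> [/eqP//|/andP[/eqP-> ->]//|/andP[/eqP-> h]].
  by rewrite ltnNge ltnW.
rewrite /join /= negrevK revK cat_take_drop -ep e6; split=> //; first exact: hp.
rewrite [in RHS]ep horizontal_negrev horizontal_cat {2}/horizontal_steps /=.
by move/eqP/negbTE: nk0 => ->.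
Qed.

Lemma Phi'E n (p : seq int) (s : seq nat) : well_labelled n (p, s) -> posp p ->
  Phi' (p, s) = canon (mtree_of_path n p s).
Proof.
rewrite well_labelledE => /and3P[/eqP hn hw hs] pp.
rewrite /Phi' /= -(relabel_id (Phi'_f _ _ _)) Phi'_fE ?map_id ?hn //.
Qed.

Lemma positiveP n (p : seq int) (s : seq nat) : well_labelled n (p, s) ->
  positive (p, s) <-> posp p.
Proof.
rewrite well_labelledE => /and3P[_ /wlab_size hw _]; rewrite /positive /=; split.
  move/allP=> h; apply: size_le_posp => -[|j] hj; first by rewrite psum0.
  by apply: h; rewrite mem_iota; lia.
by move=> h; apply/allP => j _; apply: h.
Qed.

Lemma path_of_mtree_perm t : nmarks t = 1 -> perm_eq (path_of_mtree t).2 (leaves t).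
Proof.
have att u Q l : perm_eq Q.2 l -> perm_eq (attach u Q).2 (leaves u ++ l).
  rewrite /attach => hQ; case: ifP => hu /=.
    by apply: perm_cat => //; rewrite perm_rev path_of_tree_perm.
  by case: u hu => //= m a _; rewrite perm_cons.
elim: t => // m l hl r hr; rewrite /=.
case: m => [_|] /=.
  by rewrite perm_rev; exact: (path_of_tree_perm (BNode true l r)).
rewrite add0n; case: eqP => h e; first by apply: att; apply: hr; lia.
by rewrite perm_sym perm_catC perm_sym; apply: att; apply: hl; lia.
Qed.

Lemma path_of_mtree_head t : nmarks t = 1 -> head 0 (path_of_mtree t).2 \in leaves t.
Proof.
move=> h; have hp := path_of_mtree_perm h; rewrite -(perm_mem hp) head_mem //.
rewrite -size_eq0 (perm_size hp) size_eq0; apply/eqP => e.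
by have := minleaf_mem t; rewrite e.
Qed.

Lemma attach_spec u Q : uniq (leaves u) -> wlab Q.1 Q.2 -> posp Q.1 ->
  head 0 Q.2 \notin leaves u -> wlab (attach u Q).1 (attach u Q).2 /\ posp (attach u Q).1.
Proof.
move=> uu wQ pQ hh; have [w1 m1] := path_of_tree_wlab uu.
have ne : head 0 (path_of_tree u).2 != head 0 Q.2.
  by apply: contraNneq hh => <-; exact: path_of_tree_head.
rewrite /attach; case: ifP => hu; last first.
  by split; [rewrite /= wQ | apply: posp_cons0].
split.
  by apply: wlab_join => //; case: ifP => lt; rewrite /step_ok ?eqxx /= ?lt //; lia.
by apply: posp_join => //; [exact: m1 | case: ifP].
Qed.

Lemma path_of_mtree_spec t : uniq (leaves t) -> nmarks t = 1 ->
  wlab (path_of_mtree t).1 (path_of_mtree t).2 /\ posp (path_of_mtree t).1.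
Proof.
elim: t => [m a|m l hl r hr] u; first by split=> // -[].
have := u; rewrite [leaves _]/= cat_uniq => /and3P[ul /hasPn hu ur].
case: m u => u.
  move=> _; have [w1 m1] := path_of_tree_wlab u.
  rewrite -[path_of_mtree _]/(negrev (path_of_tree (BNode true l r)).1, rev (path_of_tree (BNode true l r)).2).
  by split; [apply: wlab_negrev | apply: posp_negrev; exact: m1].
rewrite /= add0n; case: eqP => h e.
  have er : nmarks r = 1 by lia.
  have [w2 m2] := hr ur er; apply: attach_spec => //.
  by apply: hu; exact: path_of_mtree_head.
have el : nmarks l = 1 by lia.
have [w2 m2] := hl ul el; apply: attach_spec => //.
apply/negP => /hu; by rewrite path_of_mtree_head.
Qed.

(** One round of decoding: the cut is found again between [u] and [Q] whichever sign [attach] has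
    inserted, and the first piece decodes to the canonical form of [u]. *)
Lemma mtree_of_path_attach fuel u Q : uniq (leaves u) -> nmarks u = 0 ->
  wlab Q.1 Q.2 -> posp Q.1 ->
  canon (mtree_of_path fuel.+1 (attach u Q).1 (attach u Q).2) =
  canon (BNode false u (mtree_of_path fuel Q.1 Q.2)).
Proof.
move=> uu nu wQ pQ; have [w1 m1] := path_of_tree_wlab uu.
have zQ := wlab_size wQ; rewrite /attach; case: ifP => hu; last first.
  case: u hu nu {w1 m1 uu} => // -[//|] a _ _ /=.
  by rewrite zQ.
have z1 := wlab_size w1; have := m1 hu; set P := path_of_tree u in z1 w1 * => {}m1.
set x := (if _ then _ else _).
have x0 : x <> 0%R by rewrite /x; case: ifP.
have xb : (-1 <= x <= 1)%R by rewrite /x; case: ifP.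
have g1 : 0 < size P.1 by case: m1.
have hd : head 0%R (negrev P.1 ++ x :: Q.1) = 1%R.
  have <- : head 0%R (negrev P.1) = head 0%R (negrev P.1 ++ x :: Q.1).
    by move: (size_negrev P.1) g1; case: (negrev P.1) => //= <-.
  have := wlab_step 0 (wlab_negrev w1); rewrite nth0.
  rewrite head_psum1 psum_negrev; case: m1 => _ h ->.
  by have := h (size P.1 - 1) ltac:(lia); lia.
rewrite [mtree_of_path _ _ _]/= hd size_cat size_rev z1 zQ addSn addnS last_k_join //.
rewrite ltnS ltn0 oner_eq0 eqxx.
case: ifP => [/eqP|_]; first by clear; lia.
rewrite succnK.
have -> : take (size P.1) (negrev P.1 ++ x :: Q.1) = negrev P.1.
  by rewrite -(size_negrev P.1) take_size_cat.
have -> : drop (size P.1).+1 (negrev P.1 ++ x :: Q.1) = Q.1.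
  by rewrite drop_cat size_negrev ltnNge leqnSn /= subSn // subnn /= drop0.
rewrite -z1 -(size_rev P.2) take_size_cat // drop_size_cat // negrevK revK size_rev.
set v := canon (tree_of_path _ _ _).
have -> : v = canon u.
  by rewrite /v tree_of_pathK // (perm_size (path_of_tree_perm u)).
rewrite -[LHS]/(canon (BNode false (canon u) (mtree_of_path fuel Q.1 Q.2))).
rewrite -[RHS]/(canon (BNode false u (mtree_of_path fuel Q.1 Q.2))).
by apply: canon_congr => //; apply: canon_canon.
Qed.

Lemma mtree_of_path_negrev fuel P : motz P.1 -> wlab P.1 P.2 ->
  mtree_of_path fuel.+1 (negrev P.1) (rev P.2) =
  mark_root (canon (tree_of_path (size P.2) P.1 P.2)).
Proof.
case: P => p s /= m1 w1; have z1 := wlab_size w1.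
have g1 : 0 < size p by case: m1.
have hd : head 0%R (negrev p) = 1%R.
  have := wlab_step 0 (wlab_negrev w1); rewrite nth0.
  rewrite head_psum1 psum_negrev; case: m1 => _ h ->.
  by have := h (size p - 1) ltac:(lia); lia.
rewrite hd size_rev z1 last_k_negrev // !eqxx oner_eq0.
case: ifP => [|_]; first by clear -g1; lia.
rewrite succnK -z1 -(size_rev s) take_size revK size_rev.
by rewrite -(size_negrev p) take_size negrevK.
Qed.

Lemma mtree_of_pathK fuel t : uniq (leaves t) -> nmarks t = 1 ->
  size (leaves t) <= fuel ->
  canon (mtree_of_path fuel (path_of_mtree t).1 (path_of_mtree t).2) = canon t.
Proof.
elim: t fuel => [m a|m l hl r hr] [|fuel] u hm //.
- by case: m u hm.
- by have := @size_leaves_node (BNode m l r) isT; lia.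
have := u; rewrite [leaves _]/= cat_uniq => /and3P[ul hu ur]; rewrite size_cat => hf.
have zl : 0 < size (leaves l) by have := minleaf_mem l; case: (leaves l).
have zr : 0 < size (leaves r) by have := minleaf_mem r; case: (leaves r).
case: m u hm => u hm.
  have [w1 m1] := path_of_tree_wlab u; set t := BNode true l r in w1 m1.
  rewrite -[path_of_mtree _]/(negrev (path_of_tree t).1, rev (path_of_tree t).2).
  rewrite mtree_of_path_negrev //; last exact: m1.
  have -> : path_of_tree t = path_of_tree (BNode false l r) by [].
  rewrite canon_mark_root tree_of_pathK //.
  - by rewrite canon_canon // -canon_mark_root.
  - by move: hm => /=; clear; lia.
  by rewrite (perm_size (path_of_tree_perm _)).
rewrite /= add0n in hm.
have pe : path_of_mtree (BNode false l r) = if nmarks l == 0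
  then attach l (path_of_mtree r) else attach r (path_of_mtree l) by [].
rewrite pe; case: eqP => h.
  have er : nmarks r = 1 by lia.
  have [w2 m2] := path_of_mtree_spec ur er.
  by rewrite mtree_of_path_attach //; apply: canon_congr => //; apply: hr => //; lia.
have el : nmarks l = 1 by lia.
have [w2 m2] := path_of_mtree_spec ul el.
rewrite mtree_of_path_attach //; last lia.
by rewrite [RHS]canonC //; apply: canon_congr => //; apply: hl => //; lia.
Qed.

Lemma attach_canon u Q : uniq (leaves u) -> attach (canon u) Q = attach u Q.
Proof. by move=> h; rewrite /attach is_node_canon minleaf_canon path_of_tree_canon. Qed.

Lemma path_of_mtree_canon t : uniq (leaves t) -> nmarks t = 1 ->
  path_of_mtree (canon t) = path_of_mtree t.
Proof.
elim: t => // m l hl r hr u hm.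
have := u; rewrite [leaves _]/= cat_uniq => /and3P[ul _ ur].
case: m u hm => u hm.
  have rmE v : is_node v -> root_mark v ->
    path_of_mtree v = (negrev (path_of_tree v).1, rev (path_of_tree v).2).
    by case: v => //= -[].
  by rewrite !rmE ?is_node_canon ?root_mark_canon // path_of_tree_canon.
rewrite /= add0n in hm; rewrite [canon _]/=.
case: ifP => _ /=; rewrite !nmarks_canon; case: eqP => h.
- by rewrite attach_canon // hr //; lia.
- by rewrite attach_canon // hl //; lia.
- have -> : nmarks l == 0 = false by lia.
  by rewrite attach_canon // hl //; lia.
have -> : nmarks l == 0 by lia.
by rewrite attach_canon // hr //; lia.
Qed.

Lemma Phi'_bij (n k : nat) : bij_on (pos_path n k) (marked_tree n k) Phi'.
Proof.
have fwd p s : pos_path n k (p, s) ->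
    marked_tree n k (Phi' (p, s)) /\ path_of_mtree (Phi' (p, s)) = (p, s).
  case/and3P=> wl /(positiveP wl) pp hk; rewrite (Phi'E wl pp).
  move: wl; rewrite well_labelledE => /and3P[/eqP hn hw hs].
  have us : uniq s by rewrite (perm_uniq hs) iota_uniq.
  have [|e1 e2 e3 e4 e5] := mtree_of_path_spec pp hw us (fuel := n); first by rewrite hn.
  split; last by rewrite path_of_mtree_canon // (perm_uniq e2).
  rewrite /marked_tree nmarks_canon e3 nqs_canon e5 hk /= !andbT.
  rewrite (perm_trans (leaves_canon _) (perm_trans e2 hs)) /=.
  by rewrite is_canon_canon // (perm_uniq e2).
split; first by case=> p s /fwd[].
split.
  case=> p s [p' s'] h1 h2 e; have [_ e1] := fwd _ _ h1; have [_ e2] := fwd _ _ h2.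
  by rewrite -e1 -e2 e.
move=> t /and4P[hl hc /eqP hm hq].
have u : uniq (leaves t) by rewrite (perm_uniq hl) iota_uniq.
have hP := path_of_mtree_perm hm; have [w1 p1] := path_of_mtree_spec u hm.
have sz : size (leaves t) = n by rewrite (perm_size hl) size_iota.
have us : uniq (path_of_mtree t).2 by rewrite (perm_uniq hP).
have ss : size (path_of_mtree t).2 = n by rewrite (perm_size hP).
have wl : well_labelled n ((path_of_mtree t).1, (path_of_mtree t).2).
  by rewrite well_labelledE ss eqxx w1 (perm_trans hP hl).
have e : canon (mtree_of_path n (path_of_mtree t).1 (path_of_mtree t).2) = t.
  by rewrite mtree_of_pathK ?sz // canon_id.
exists ((path_of_mtree t).1, (path_of_mtree t).2); split; last by rewrite (Phi'E wl p1).
apply/and3P; split=> //; first exact/(positiveP wl).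
have [|_ _ _ _ <-] := mtree_of_path_spec p1 w1 us (fuel := n); first by rewrite ss.
by rewrite -nqs_canon e.
Qed.

(** * Labelled vertices and the characterisation of Chen labellings *)

(** Every vertex is labelled, the root included; marks are absent because Chen's labelling only
    concerns the unmarked tree. *)
Inductive ltree := LLeaf of nat | LNode of nat & ltree & ltree.

Definition rl (T : ltree) : nat := match T with LLeaf x => x | LNode c _ _ => c end.

Fixpoint lshape (T : ltree) : btree :=
  match T with
  | LLeaf x => BLeaf false x
  | LNode _ l r => BNode false (lshape l) (lshape r)
  end.

Fixpoint labs (T : ltree) : seq nat :=
  match T with LLeaf x => [:: x] | LNode c l r => c :: labs l ++ labs r end.

(* (c, x, y): an internal vertex labelled c with children labelled x and y. *)
Fixpoint lnodes (T : ltree) : seq (nat * nat * nat) :=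
  match T with
  | LLeaf _ => [::]
  | LNode c l r => (c, rl l, rl r) :: lnodes l ++ lnodes r
  end.

Definition nlabs (T : ltree) : seq nat := [seq q.1.1 | q <- lnodes T].
Definition kids (T : ltree) : seq nat := flatten [seq [:: q.1.2; q.2] | q <- lnodes T].

Definition increasing (T : ltree) : Prop :=
  forall c x y, (c, x, y) \in lnodes T -> x < c /\ y < c.

(* Chen's rule: when c is attributed, every other vertex both of whose children
   are already labelled has a larger least child label. *)
Definition greedy (T : ltree) : Prop :=
  forall c x y c' x' y', (c, x, y) \in lnodes T -> (c', x', y') \in lnodes T ->
  c < c' -> x' < c -> y' < c -> minn x y < minn x' y'.

(** Leaf labels [A] and first internal label [c] are kept free for the sake of induction:
    contracting two sibling leaves turns them into a leaf [c] and makes c+1 the next label. The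
    length of the interval is the number of internal vertices of a binary tree with [size A]
    leaves. *)
Definition chen (A : seq nat) (c : nat) (T : ltree) : Prop :=
  [/\ perm_eq (leaves (lshape T)) A, perm_eq (nlabs T) (iota c (size A).-1),
      increasing T & greedy T].

Lemma labs_perm T : perm_eq (labs T) (leaves (lshape T) ++ nlabs T).
Proof.
elim: T => //= c l /permP hl r /permP hr; apply/permP => P.
have := hl P; have := hr P; rewrite /nlabs /= map_cat /= !count_cat /= !count_cat.
by move=> -> ->; clear; lia.
Qed.

Lemma labs_kids T : perm_eq (labs T) (rl T :: kids T).
Proof.
elim: T => //= c l /permP hl r /permP hr; apply/permP => P.
have := hl P; have := hr P; rewrite /kids /= map_cat flatten_cat /= !count_cat /=.
by move=> -> ->; clear; lia.
Qed.

Lemma chen_uniq A c T : uniq A -> all (fun x => x < c) A -> chen A c T ->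
  uniq (labs T).
Proof.
move=> uA /allP hA [h1 h2 _ _]; rewrite (perm_uniq (labs_perm T)) cat_uniq.
rewrite (perm_uniq h1) uA (perm_uniq h2) iota_uniq andbT; apply/hasPn => x.
rewrite (perm_mem h2) mem_iota (perm_mem h1) => hx; apply/negP => /hA; lia.
Qed.

Lemma mem_kids T x : reflect (exists c y, (c, x, y) \in lnodes T \/ (c, y, x) \in lnodes T)
  (x \in kids T).
Proof.
apply: (iffP flattenP) => [[s /mapP[[[c u] v] h ->]]|[c [y [] h]]].
- by rewrite !inE /= => /orP[] /eqP ->; [exists c, v; left|exists c, u; right].
- by exists [:: x; y]; rewrite ?inE ?eqxx //; apply/mapP; exists (c, x, y).
by exists [:: y; x]; rewrite ?inE ?eqxx ?orbT //; apply/mapP; exists (c, y, x).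
Qed.

Lemma rl_max T : increasing T -> forall x, x \in labs T -> x <= rl T.
Proof.
elim: T => [x|c l hl r hr] hI y /=; first by rewrite inE => /eqP ->.
have [h1 h2] : rl l < c /\ rl r < c by apply: hI; rewrite /= inE eqxx.
rewrite inE mem_cat => /or3P[/eqP -> //| h | h].
  apply: leq_trans (ltnW h1); apply: hl => // d u v hd.
  by apply: hI; rewrite /= inE mem_cat hd orbT.
apply: leq_trans (ltnW h2); apply: hr => // d u v hd.
by apply: hI; rewrite /= inE mem_cat hd !orbT.
Qed.

(** * Contraction and expansion of a pair of sibling leaves *)

Fixpoint bexpand (c a b : nat) (t : btree) : btree :=
  match t with
  | BLeaf m x => if x == c then BNode false (BLeaf false a) (BLeaf false b) else BLeaf m x
  | BNode m l r => BNode m (bexpand c a b l) (bexpand c a b r)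
  end.

Fixpoint lexpand (c a b : nat) (T : ltree) : ltree :=
  match T with
  | LLeaf x => if x == c then LNode c (LLeaf a) (LLeaf b) else LLeaf x
  | LNode d l r => LNode d (lexpand c a b l) (lexpand c a b r)
  end.

Lemma rl_lexpand c a b T : rl (lexpand c a b T) = rl T.
Proof. by case: T => //= x; case: eqP => [->|]. Qed.

Lemma lshape_lexpand c a b T : lshape (lexpand c a b T) = bexpand c a b (lshape T).
Proof. by elim: T => [x|d l hl r hr] /=; [case: eqP | rewrite hl hr]. Qed.

Lemma bexpand_id c a b t : c \notin leaves t -> bexpand c a b t = t.
Proof.
elim: t => [m x|m l hl r hr] /=; first by rewrite inE eq_sym => /negbTE ->.
by rewrite mem_cat negb_or => /andP[/hl -> /hr ->].
Qed.

Lemma lexpand_id c a b T : c \notin leaves (lshape T) -> lexpand c a b T = T.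
Proof.
elim: T => [x|d l hl r hr] /=; first by rewrite inE eq_sym => /negbTE ->.
by rewrite mem_cat negb_or => /andP[/hl -> /hr ->].
Qed.

Lemma leaves_bexpand c a b t : uniq (leaves t) -> c \in leaves t ->
  perm_eq (c :: leaves (bexpand c a b t)) (a :: b :: leaves t).
Proof.
elim: t => [m x|m l hl r hr] /=.
  by rewrite inE => _ /eqP ->; rewrite eqxx; apply/permP => P /=; clear; lia.
rewrite cat_uniq mem_cat => /and3P[ul /hasPn hu ur].
case: (boolP (c \in leaves l)) => [cl _|cl /= cr].
  rewrite (@bexpand_id c a b r); last by apply/negP => /hu /=; rewrite cl.
  have /permP hp := hl ul cl; apply/permP => P; have := hp P.
  by rewrite /= !count_cat; clear; lia.
rewrite (@bexpand_id c a b l) //.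
have /permP hp := hr ur cr; apply/permP => P; have := hp P.
by rewrite /= !count_cat; clear; lia.
Qed.

Lemma lnodes_lexpand c a b T : uniq (leaves (lshape T)) -> c \in leaves (lshape T) ->
  perm_eq (lnodes (lexpand c a b T)) ((c, a, b) :: lnodes T).
Proof.
elim: T => [x|d l hl r hr] /=.
  by rewrite inE => _ /eqP ->; rewrite eqxx.
rewrite cat_uniq mem_cat => /and3P[ul /hasPn hu ur]; rewrite !rl_lexpand.
case: (boolP (c \in leaves (lshape l))) => [cl _|cl /= cr].
  rewrite (@lexpand_id c a b r); last by apply/negP => /hu /=; rewrite cl.
  have /permP hp := hl ul cl; apply/permP => P; have := hp P.
  by rewrite /= !count_cat /= => ->; clear; lia.
rewrite (@lexpand_id c a b l) //.
have /permP hp := hr ur cr; apply/permP => P; have := hp P.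
by rewrite /= !count_cat /= => ->; clear; lia.
Qed.

(** Induction step shared by the existence results for trees and for matchings. Since [c] is below
    all other internal labels, the only new instances of greediness compare [c] with a vertex whose
    children are both labelled below [c]; the last hypothesis settles them. *)
Lemma chen_lexpand A A' a b c T : uniq A -> all (fun x => x < c) A ->
  a < c -> b < c -> perm_eq (c :: A) [:: a, b & A'] -> chen A' c.+1 T ->
  (forall c' x' y', (c', x', y') \in lnodes T -> x' < c -> y' < c ->
     minn a b < minn x' y') ->
  chen A c (lexpand c a b T).
Proof.
move=> uA /allP hA ac bc hp [h1 h2 h3 h4] key.
have cA : c \notin A by apply/negP => /hA; rewrite ltnn.
have u0 : uniq [:: a, b & A'] by rewrite -(perm_uniq hp) /= cA.
have uA' : uniq A' by move: u0 => /= /and3P[].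
have sz : size A = (size A').+1 by have /= := perm_size hp => -[].
have cA' : c \in A'.
  have : c \in [:: a, b & A'] by rewrite -(perm_mem hp) inE eqxx.
  by rewrite !inE !gtn_eqF.
have sA' : 0 < size A' by case: (A') cA'.
have uT : uniq (leaves (lshape T)) by rewrite (perm_uniq h1).
have cT : c \in leaves (lshape T) by rewrite (perm_mem h1).
have hn := lnodes_lexpand a b uT cT.
have cb d x y : (d, x, y) \in lnodes T -> c < d.
  move=> hd; have : d \in nlabs T by apply/mapP; exists (d, x, y).
  by rewrite (perm_mem h2) mem_iota => /andP[].
split.
- rewrite lshape_lexpand -(perm_cons c); apply: perm_trans (leaves_bexpand _ _ uT cT) _.
  by rewrite perm_sym; apply: perm_trans hp _; rewrite !perm_cons perm_sym.
- have := perm_map (fun q => q.1.1) hn; rewrite -/(nlabs _) /= -/(nlabs T) => hq.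
  apply: perm_trans hq _; rewrite sz /=; case: (size A') h2 sA' => // k h2 _ /=.
  by rewrite perm_cons.
- move=> d x y; rewrite (perm_mem hn) inE => /orP[/eqP[-> -> ->]|/h3] //.
move=> d x y d' x' y'; rewrite !(perm_mem hn) !inE.
move=> /orP[/eqP[-> -> ->]|hd] /orP[/eqP[-> -> ->]|hd'].
- by rewrite ltnn.
- by move=> _; apply: (key d').
- by move=> dc; have := cb _ _ _ hd; clear -dc; lia.
by move=> dd' hx hy; apply: (h4 d x y d' x' y').
Qed.

(** These are the vertices eligible at the outset of Chen's rule; on a leaf, [minleaf] just reads
    the label. *)
Fixpoint cherries (t : btree) : seq (nat * nat) :=
  match t with
  | BLeaf _ _ => [::]
  | BNode _ l r => (if is_node l || is_node r then [::] else [:: (minleaf l, minleaf r)])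
                   ++ cherries l ++ cherries r
  end.

Lemma cherries_node t : is_node t -> cherries t != [::].
Proof.
elim: t => // m l hl r hr _ /=; case: l hl => [ml x|ml l1 l2] hl /=.
  by case: r hr => [mr y|mr r1 r2] hr //=; apply: hr.
by rewrite -size_eq0 size_cat addn_eq0 negb_and size_eq0 hl.
Qed.

Lemma cherries_mem a b t : (a, b) \in cherries t -> a \in leaves t /\ b \in leaves t.
Proof.
elim: t => // m l hl r hr /=; rewrite !mem_cat => /or3P[|/hl[-> ->]|/hr[-> ->]] //.
  by case: ifP => // _; rewrite inE => /eqP[-> ->]; rewrite !minleaf_mem orbT.
by rewrite !orbT.
Qed.

Lemma contract_cherry a b c t : nmarks t = 0 -> c \notin leaves t ->
  (a, b) \in cherries t ->
  exists t', [/\ nmarks t' = 0, bexpand c a b t' = t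
               & perm_eq (c :: leaves t) [:: a, b & leaves t']].
Proof.
elim: t => // m l hl r hr; rewrite [nmarks _]/= [leaves _]/= [cherries _]/=.
case: m => // hm; rewrite add0n in hm; rewrite !mem_cat negb_or => /andP[cl cr].
have [ml mr] : nmarks l = 0 /\ nmarks r = 0 by clear -hm; lia.
case/or3P.
- case: l {hl} ml {hm cl} => // -[//|] x _; case: r {hr} mr {cr} => // -[//|] y _ /=.
  rewrite inE => /eqP[-> ->]; exists (BLeaf false c); rewrite /= eqxx; split=> //.
  by apply/permP => P /=; clear; lia.
- move=> h; have [l' [h1 h2 /permP h3]] := hl ml cl h.
  exists (BNode false l' r); split; rewrite /= ?h1 ?mr //; first by rewrite h2 bexpand_id.
  by apply/permP => P; have := h3 P; rewrite /= !count_cat; clear; lia.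
move=> h; have [r' [h1 h2 /permP h3]] := hr mr cr h.
exists (BNode false l r'); split; rewrite /= ?h1 ?ml //; first by rewrite h2 bexpand_id.
by apply/permP => P; have := h3 P; rewrite /= !count_cat; clear; lia.
Qed.

Lemma lnodes_cherry T c x y : (c, x, y) \in lnodes T -> x \notin nlabs T ->
  y \notin nlabs T -> (x, y) \in cherries (lshape T).
Proof.
elim: T => // d l hl r hr; rewrite /= !mem_cat inE mem_cat /nlabs /= map_cat.
rewrite !inE !mem_cat !negb_or => /or3P[/eqP[_ -> ->]|h|h] /and3P[_ x1 x2] /and3P[_ y1 y2].
- case: l x1 {hl x2 y1} => [u|u l1 l2]; last by rewrite /= inE eqxx.
  by case: r y2 {hr} => [v|v r1 r2] /=; rewrite ?inE eqxx.
- by rewrite hl ?orbT.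
by rewrite hr ?orbT.
Qed.

Lemma seq_min (T : eqType) (key : T -> nat) (s : seq T) : s != [::] ->
  exists2 x, x \in s & forall y, y \in s -> key x <= key y.
Proof.
elim: s => // x s IH _; case: (altP (s =P [::])) => [->|/IH [z zs hz]].
  by exists x; rewrite ?inE // => y; rewrite inE => /eqP ->.
case: (leqP (key x) (key z)) => h.
  exists x; rewrite ?inE ?eqxx // => y; rewrite inE => /orP[/eqP -> //|/hz].
  exact: leq_trans.
exists z; rewrite ?inE ?zs ?orbT // => y; rewrite inE => /orP[/eqP ->|/hz //].
exact: ltnW.
Qed.

Lemma chen_exists t c : uniq (leaves t) -> all (fun x => x < c) (leaves t) ->
  nmarks t = 0 -> exists T, lshape T = t /\ chen (leaves t) c T.
Proof.
have [n] := ubnP (size (leaves t)); elim: n t c => // n IH t c hn ut hA hm.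
case nt : (is_node t); last first.
  case: t nt ut hA hm {hn} => // -[//|] x _ _ _ _; exists (LLeaf x); split=> //.
have ncn := cherries_node nt.
have [[a b] hab hmin] := seq_min (fun q => minn q.1 q.2) ncn.
have [ha hb] := cherries_mem hab; have /allP hA' := hA.
have ct : c \notin leaves t by apply/negP => /hA'; rewrite ltnn.
have [t' [m1 m2 m3]] := contract_cherry hm ct hab.
have u0 : uniq [:: a, b & leaves t'] by rewrite -(perm_uniq m3) /= ct.
have ac := hA' _ ha; have bc := hA' _ hb.
have [||||T [hT1 hT2]] := IH t' c.+1.
- by have := perm_size m3; rewrite /=; clear -hn; lia.
- by move: u0 => /= /and3P[].
- apply/allP => x hx; have : x \in c :: leaves t.
    by rewrite (perm_mem m3) !inE hx !orbT.
  by rewrite inE ltnS => /orP[/eqP ->//|/hA' /ltnW].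
- exact: m1.
have sT : lshape (lexpand c a b T) = t by rewrite lshape_lexpand hT1.
exists (lexpand c a b T); split=> //.
apply: (chen_lexpand ut hA ac bc m3 hT2) => c' x' y' hl hx hy.
have [p1 p2 p3 p4] := hT2.
have ct' : c \in leaves (lshape T).
  rewrite hT1; have : c \in [:: a, b & leaves t'] by rewrite -(perm_mem m3) inE eqxx.
  by rewrite !inE !gtn_eqF.
have uT : uniq (leaves (lshape T)) by rewrite hT1; move: u0 => /= /and3P[].
have hp := lnodes_lexpand a b uT ct'.
have ge z : z \in nlabs (lexpand c a b T) -> c <= z.
  rewrite (perm_mem (perm_map _ hp)) /= inE => /orP[/eqP -> //|].
  by rewrite -/(nlabs T) (perm_mem p2) mem_iota => /andP[/ltnW].
have hl' : (c', x', y') \in lnodes (lexpand c a b T).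
  by rewrite (perm_mem hp) inE hl orbT.
(* Internal labels are at least [c], so children labelled below [c] are leaves: every competitor of
   [c] is a pair of leaves of [t], already compared with [(a, b)]. *)
have ch : (x', y') \in cherries t.
  rewrite -sT; apply: lnodes_cherry hl' _ _; apply/negP => /ge; clear -hx hy; lia.
have le := hmin _ ch; rewrite /= in le.
have xk : x' \in labs T.
  rewrite (perm_mem (labs_kids T)) inE; apply/orP; right.
  by apply/mem_kids; exists c', y'; left.
have yk : y' \in labs T.
  rewrite (perm_mem (labs_kids T)) inE; apply/orP; right.
  by apply/mem_kids; exists c', x'; right.
(* This makes the inequality strict: [a] and [b] have disappeared from the contracted tree. *)
have nl z : z \in labs T -> z < c -> a != z /\ b != z.
  rewrite (perm_mem (labs_perm T)) mem_cat hT1 => /orP[hz _|].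
    move: u0; rewrite /= inE negb_or => /and3P[/andP[_ na] nb _].
    by split; [apply: contraNneq na => -> | apply: contraNneq nb => ->].
  by rewrite (perm_mem p2) mem_iota => /andP[h _]; clear -h; lia.
have [n1 n2] := nl _ xk hx; have [n3 n4] := nl _ yk hy.
clear -le n1 n2 n3 n4; lia.
Qed.

(** * Sibling matchings and their realisation by Chen labellings *)

Definition adj (T : ltree) (c x y : nat) : Prop :=
  (c, x, y) \in lnodes T \/ (c, y, x) \in lnodes T.

Lemma adjC T c x y : adj T c x y -> adj T c y x.
Proof. by case; [right|left]. Qed.

Definition follows (f : nat -> nat) (T : ltree) : Prop :=
  forall c x y, adj T c x y -> f x = y.

Lemma adj_labs T c x y : adj T c x y -> x \in labs T.
Proof.
move=> h; rewrite (perm_mem (labs_kids T)) inE; apply/orP; right.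
by apply/mem_kids; exists c, y.
Qed.

(** There are m+2 leaf labels but only m other matched labels, so some two leaf labels are partners
    and can be contracted. The label c+m is left to the root, which has no sibling and stays outside
    the matching. *)
Lemma chen_of_matching (f : nat -> nat) (m : nat) (A : seq nat) (c : nat) :
  uniq A -> all (fun x => x < c) A -> size A = m.+2 ->
  (forall x, x \in A ++ iota c m ->
     [/\ f x \in A ++ iota c m, f (f x) = x & f x != x]) ->
  exists T, chen A c T /\ follows f T.
Proof.
elim: m A c => [|m IH] A c uA hA sA hf.
  case: A uA hA sA hf => [|x [|y [|z A]]] //=; rewrite inE andbT => xy /and3P[xc yc _] _ hf.
  have [] := hf x; rewrite ?inE ?eqxx // => fx ffx nx.
  have {}fx : f x = y by move: fx; rewrite ?inE (negbTE nx) => /eqP.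
  exists (LNode c (LLeaf x) (LLeaf y)); split.
    split=> //=.
    - by move=> d u v; rewrite inE => /eqP[-> -> ->].
    move=> d u v d' u' v'; rewrite /= !inE => /eqP[-> _ _] /eqP[-> _ _].
    by rewrite ltnn.
  by move=> d u v []; rewrite /= inE => /eqP[_ -> ->]; rewrite -fx ?ffx.
have /allP hA' := hA.
have ex : exists x, (x \in A) && (f x \in A).
  case: (boolP (has (fun x => f x \in A) A)) => [/hasP[x h1 h2]|/hasPn hn].
    by exists x; rewrite h1.
  have inj : {in A &, injective f}.
    move=> x y hx hy e; have [|_ ex _] := hf x; first by rewrite mem_cat hx.
    by have [|_ ey _] := hf y; [rewrite mem_cat hy | rewrite -ex e ey].
  have sub : {subset map f A <= iota c m.+1}.
    move=> z /mapP[x hx ->]; have [|h _ _] := hf x; first by rewrite mem_cat hx.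
    by move: h; rewrite mem_cat (negbTE (hn _ hx)).
  have um : uniq (map f A) by rewrite map_inj_in_uniq.
  have := uniq_leq_size um sub.
  by rewrite size_map size_iota sA ltnNge leqnSn.
(* The partner of [a] satisfies the same condition, so [a] is the least label of any pair contained
   in [A]. *)
case: (ex_minnP ex) => a /andP[aA faA] amin; set b := f a in faA.
have [|_ fb ba] := hf a; first by rewrite mem_cat aA.
rewrite -/b in fb ba.
have ac := hA' _ aA; have bc := hA' _ faA.
have cA : c \notin A by apply/negP => /hA'; rewrite ltnn.
pose A' := c :: rem b (rem a A).
have brA : b \in rem a A by rewrite mem_rem_uniq // inE ba faA.
have pA : perm_eq (c :: A) [:: a, b & A'].
  have h1 := perm_to_rem aA; have h2 := perm_to_rem brA.
  apply/permP => P; move/permP/(_ P): h1 => /= ->; move/permP/(_ P): h2 => /= ->.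
  by clear; lia.
clearbody A'; have u0 : uniq [:: a, b & A'] by rewrite -(perm_uniq pA) /= cA.
have uA' : uniq A' by move: u0 => /= /and3P[].
have nA' : a \notin A' /\ b \notin A'.
  by move: u0; rewrite [uniq _]/= inE negb_or => /and3P[/andP[_ ->] -> _].
have memA' x : x \in A' = [&& x \in c :: A, x != a & x != b].
  rewrite (perm_mem pA) !inE; case: eqP => [->|_] /=.
    by apply/negbTE; case: nA'.
  by case: eqP => [->|_] //=; [apply/negbTE; case: nA' | rewrite andbT].
(* Contraction moves [c] from the interval to the leaf labels and discards [a] and [b], a pair of
   partners, so [f] restricts to a matching of what remains. *)
have memD x : x \in A' ++ iota c.+1 m = [&& x \in A ++ iota c m.+1, x != a & x != b].
  rewrite !mem_cat memA' inE /= inE; case hx : (x \in iota c.+1 m) => //=.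
    rewrite !orbT /=; move: hx; rewrite mem_iota => hx.
    by symmetry; apply/andP; split; apply/eqP => e; clear -hx e ac bc; lia.
  by rewrite !orbF orbC.
have [|||T [hT fT]] := IH A' c.+1 uA'.
- apply/allP => x; rewrite memA' inE => /and3P[/orP[/eqP ->//|/hA'] h _ _].
  exact: ltnW.
- by have := perm_size pA; rewrite [size (c :: A)]/= sA => -[].
- move=> x; rewrite memD => /and3P[hx xa xb]; have [h1 h2 h3] := hf _ hx.
  rewrite memD h1 h2 h3; split=> //; apply/and3P; split=> //.
    by apply/eqP => e; move/eqP: xb; apply; rewrite /b -e h2.
  by apply/eqP => e; move/eqP: xa; apply; rewrite -fb -e h2.
have kA x d y : adj T d x y -> x < c -> x \in A /\ x != a.
  move=> /adj_labs; rewrite (perm_mem (labs_perm T)) mem_cat; case: hT => p1 p2 _ _.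
  rewrite (perm_mem p1) (perm_mem p2) memA' inE mem_iota => /orP[|/andP[h _] h2].
    by move=> /and3P[/orP[/eqP ->|->] -> _] //; rewrite ltnn.
  by clear -h h2; lia.
exists (lexpand c a b T); split.
  apply: (chen_lexpand uA hA ac bc pA hT) => c' x' y' hl hx hy.
  have a1 : adj T c' x' y' by left.
  have [xA xa] := kA _ _ _ a1 hx; have [yA ya] := kA _ _ _ (adjC a1) hy.
  have fx := fT _ _ _ a1; have fy := fT _ _ _ (adjC a1).
  have lx : a <= x' by apply: amin; rewrite xA fx.
  have ly : a <= y' by apply: amin; rewrite yA fy.
  by clear -lx ly xa ya; lia.
have [p1 _ _ _] := hT.
have hp : perm_eq (lnodes (lexpand c a b T)) ((c, a, b) :: lnodes T).
  apply: lnodes_lexpand; first by rewrite (perm_uniq p1).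
  by rewrite (perm_mem p1) memA' inE eqxx !gtn_eqF.
move=> d x y []; rewrite (perm_mem hp) inE => /orP[/eqP[_ -> ->] //|h].
- by apply: (fT d); left.
- by apply: (fT d); right.
Qed.

Fixpoint lcanon (T : ltree) : ltree :=
  match T with
  | LLeaf x => LLeaf x
  | LNode c l r => let l' := lcanon l in let r' := lcanon r in
      if minleaf (lshape l') <= minleaf (lshape r') then LNode c l' r' else LNode c r' l'
  end.

Lemma lshape_lcanon T : lshape (lcanon T) = canon (lshape T).
Proof. by elim: T => //= c l <- r <-; case: ifP. Qed.

Lemma rl_lcanon T : rl (lcanon T) = rl T.
Proof. by case: T => //= c l r; case: ifP. Qed.

Lemma nlabs_lcanon T : perm_eq (nlabs (lcanon T)) (nlabs T).
Proof.
elim: T => //= c l /permP hl r /permP hr; case: ifP => _; apply/permP => P;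
  have := hl P; have := hr P; rewrite /nlabs /= !map_cat !count_cat => -> ->;
  clear; lia.
Qed.

Lemma adj_lcanon T c x y : adj (lcanon T) c x y -> adj T c x y.
Proof.
suff h q : q \in lnodes (lcanon T) -> adj T q.1.1 q.1.2 q.2.
  by case=> /h //; apply: adjC.
elim: T => //= d l hl r hr; case: ifP => _; rewrite /= inE mem_cat !rl_lcanon.
  move=> /or3P[/eqP->|/hl|/hr] /=; rewrite /adj /=; first by left; rewrite inE eqxx.
    by case=> h; [left|right]; rewrite inE mem_cat h orbT.
  by case=> h; [left|right]; rewrite inE mem_cat h !orbT.
move=> /or3P[/eqP->|/hr|/hl] /=; rewrite /adj /=; first by right; rewrite inE eqxx.
  by case=> h; [left|right]; rewrite inE mem_cat h !orbT.
by case=> h; [left|right]; rewrite inE mem_cat h orbT.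
Qed.

Lemma adj_increasing T c x y : increasing T -> adj T c x y -> x < c /\ y < c.
Proof. by move=> hT [/hT[]|/hT[]]. Qed.

Lemma adj_greedy T c x y c' x' y' : greedy T -> adj T c x y -> adj T c' x' y' ->
  c < c' -> x' < c -> y' < c -> minn x y < minn x' y'.
Proof.
move=> hT h1 h2 lt hx hy.
case: h1 => h1; case: h2 => h2; have := hT _ _ _ _ _ _ h1 h2 lt.
- exact.
- by rewrite [minn y' x']minnC; apply.
- by rewrite [minn y x]minnC; apply.
by rewrite [minn y x]minnC [minn y' x']minnC; apply.
Qed.

Lemma chen_lcanon A c T : chen A c T -> chen A c (lcanon T).
Proof.
case=> h1 h2 h3 h4; split.
- by rewrite lshape_lcanon; apply: perm_trans (leaves_canon _) h1.
- exact: perm_trans (nlabs_lcanon _) h2.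
- by move=> d x y h; apply: adj_increasing h3 _; apply: adj_lcanon; left.
move=> d x y d' x' y' h h'; apply: (adj_greedy h4); apply: adj_lcanon; by left.
Qed.

Lemma follows_lcanon f T : follows f T -> follows f (lcanon T).
Proof. by move=> h c x y /adj_lcanon /h. Qed.

(** * Addresses of vertices and uniqueness of Chen labellings *)

Fixpoint lsubt (T : ltree) (a : seq bool) {struct a} : option ltree :=
  match a with
  | [::] => Some T
  | b :: a' => match T with LLeaf _ => None | LNode _ l r => lsubt (if b then r else l) a' end
  end.

Definition lat (T : ltree) (a : seq bool) : option nat := omap rl (lsubt T a).

Lemma lsubt_rcons T p b : lsubt T (rcons p b) =
  if lsubt T p is Some (LNode _ l r) then Some (if b then r else l) else None.
Proof. by elim: p T => [|b' p IH] [x|c l r] //=; apply: IH. Qed.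

Lemma subt_lshape T a : subt (lshape T) a = omap lshape (lsubt T a).
Proof. by elim: a T => [|b a IH] [x|c l r] //=; case: b; apply: IH. Qed.

Lemma lsubt_labs T a U : lsubt T a = Some U -> {subset labs U <= labs T}.
Proof.
elim: a T => [|b a IH] [x|c l r] //=; try by move=> [<-].
by move=> /IH h x /h; rewrite inE mem_cat; case: b {h} => ->; rewrite !orbT.
Qed.

Lemma rl_labs T : rl T \in labs T.
Proof. by case: T => [x|c l r] /=; rewrite inE eqxx. Qed.

Lemma lat_labs T a x : lat T a = Some x -> x \in labs T.
Proof.
rewrite /lat; case e : (lsubt T a) => [U|] //= [<-].
exact: (lsubt_labs e) (rl_labs U).
Qed.

Lemma labs_lat T x : x \in labs T -> exists a, lat T a = Some x.
Proof.
elim: T => [y|c l hl r hr] /=; first by rewrite inE => /eqP ->; exists [::].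
rewrite inE mem_cat => /or3P[/eqP ->|/hl[a h]|/hr[a h]]; first by exists [::].
- by exists (false :: a).
- by exists (true :: a).
Qed.

Lemma lat_inj T a a' x : uniq (labs T) -> lat T a = Some x -> lat T a' = Some x -> a = a'.
Proof.
elim: T a a' => [y|c l hl r hr]; first by case=> [|b a] [|b' a'].
rewrite /= mem_cat negb_or cat_uniq => a a' /andP[/andP[cl cr] /and3P[ul /hasPn hu ur]].
case: a a' => [|b a] [|b' a'] //.
- move=> [<-]; case: b' => h; have := lat_labs (T := _) (a := a') h => hc.
    by rewrite hc in cr.
  by rewrite hc in cl.
- move=> h [e]; move: h; rewrite -e; case: b => h; have := lat_labs (T := _) (a := a) h => hc.
    by rewrite hc in cr.
  by rewrite hc in cl.
case: b b' => -[] h h'.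
- by rewrite (hr _ _ ur h h').
- by have := hu _ (lat_labs (T := r) h); rewrite /= (lat_labs (T := l) h').
- by have := hu _ (lat_labs (T := r) h'); rewrite /= (lat_labs (T := l) h).
by rewrite (hl _ _ ul h h').
Qed.

Lemma lsubt_lnodes T p c l r : lsubt T p = Some (LNode c l r) ->
  (c, rl l, rl r) \in lnodes T.
Proof.
elim: p T => [|b p IH] [x|d l' r'] //=; first by move=> [-> -> ->]; rewrite inE eqxx.
by move=> /IH; rewrite inE mem_cat; case: b => ->; rewrite !orbT.
Qed.

Lemma lnodes_lsubt T c x y : (c, x, y) \in lnodes T ->
  exists p l r, [/\ lsubt T p = Some (LNode c l r), rl l = x & rl r = y].
Proof.
elim: T => // d l hl r hr; rewrite /= inE mem_cat.
move=> /or3P[/eqP[-> -> ->]|/hl|/hr]; first by exists [::], l, r.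
- by move=> [p [l1 [r1 [h1 h2 h3]]]]; exists (false :: p), l1, r1.
by move=> [p [l1 [r1 [h1 h2 h3]]]]; exists (true :: p), l1, r1.
Qed.

Lemma adj_lat T c x y : adj T c x y -> exists p b,
  lat T (rcons p b) = Some x /\ lat T (rcons p (~~ b)) = Some y.
Proof.
case=> /lnodes_lsubt[p [l [r [h h1 h2]]]].
  by exists p, false; rewrite /lat !lsubt_rcons h /= h1 h2.
by exists p, true; rewrite /lat !lsubt_rcons h /= h1 h2.
Qed.

Lemma lat_adj T p b x : lat T (rcons p b) = Some x ->
  exists c y, adj T c x y /\ lat T (rcons p (~~ b)) = Some y.
Proof.
rewrite /lat !lsubt_rcons; case e : (lsubt T p) => [[z|c l r]|] //= [<-].
have := lsubt_lnodes e; exists c; case: b; [exists (rl l)|exists (rl r)]; split=> //.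
  by right.
by left.
Qed.

Lemma adj_fun T c c' x y y' : uniq (labs T) -> adj T c x y -> adj T c' x y' ->
  c = c' /\ y = y'.
Proof.
move=> u h h'; have key d z : adj T d x z -> exists p b, [/\ lat T (rcons p b) = Some x,
    lat T p = Some d & lat T (rcons p (~~ b)) = Some z].
  case=> /lnodes_lsubt[p [l [r [e e1 e2]]]].
    by exists p, false; rewrite /lat !lsubt_rcons e /= e1 e2.
  by exists p, true; rewrite /lat !lsubt_rcons e /= e1 e2.
have [p [b [k1 k2 k3]]] := key _ _ h; have [p' [b' [k1' k2' k3']]] := key _ _ h'.
have := lat_inj u k1 k1' => /rcons_inj[ep eb]; subst p' b'.
by move: k2' k3'; rewrite k2 k3 => -[->] [->].
Qed.

Lemma node_fun T c x y x' y' : uniq (labs T) -> (c, x, y) \in lnodes T ->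
  (c, x', y') \in lnodes T -> x = x' /\ y = y'.
Proof.
move=> u /lnodes_lsubt[p [l [r [h h1 h2]]]] /lnodes_lsubt[p' [l' [r' [h' h1' h2']]]].
have e : p = p' by apply: (lat_inj (T := T) (x := c)) => //; rewrite /lat ?h ?h'.
by move: h'; rewrite -e h => -[el er]; rewrite -h1 -h2 -h1' -h2' el er.
Qed.

Lemma adj_node_fun T c x y x' y' : uniq (labs T) -> adj T c x y ->
  (c, x', y') \in lnodes T -> (x' = x /\ y' = y) \/ (x' = y /\ y' = x).
Proof. by move=> u [] h h'; have [-> ->] := node_fun u h h'; [left|right]. Qed.

Lemma nlabs_node T c : c \in nlabs T -> exists x y, (c, x, y) \in lnodes T.
Proof. by move=> /mapP[[[d x] y] h /= ->]; exists x, y. Qed.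

Lemma labs_adj T x : x \in labs T -> x != rl T -> exists c y, adj T c x y.
Proof.
by rewrite (perm_mem (labs_kids T)) inE => /orP[->//|/mem_kids[c [y h]]] _; exists c, y.
Qed.

(** Siblings are prescribed by [f], so only the label of their parent is in question. Let [x], [y]
    have parent [d] in [T] and [e] in [T']. The induction hypothesis, applied from [T'] to [T],
    excludes e < d. If e > d, the children of [e] lie below [d], so by greediness of [T'] the pair
    under [d] there has a strictly smaller least label. Exchanging the trees reverses this strict
    inequality, a contradiction. *)
Lemma chen_nodes_sub (A : seq nat) (c0 : nat) (f : nat -> nat) d (T T' : ltree) x y :
  uniq A -> all (fun x => x < c0) A -> chen A c0 T -> chen A c0 T' ->
  follows f T -> follows f T' -> adj T d x y -> adj T' d x y.
Proof.
move=> uA hA; elim/ltn_ind: d T T' x y => d IH.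
have step (T T' : ltree) x y x' y' : chen A c0 T -> chen A c0 T' ->
  follows f T -> follows f T' -> adj T d x y -> (d, x', y') \in lnodes T' ->
  adj T' d x y \/ minn x' y' < minn x y.
  move=> cT cT' fT fT' h h'.
  have u := chen_uniq uA hA cT; have u' := chen_uniq uA hA cT'.
  have [p1 p2 p3 p4] := cT; have [p1' p2' p3' p4'] := cT'.
  have [xd yd] := adj_increasing p3 h.
  have pm : perm_eq (labs T) (labs T').
    apply: perm_trans (labs_perm T) _; rewrite perm_sym.
    apply: perm_trans (labs_perm T') _; apply: perm_cat.
      by apply: perm_trans p1' _; rewrite perm_sym.
    by apply: perm_trans p2' _; rewrite perm_sym.
  have xT' : x \in labs T' by rewrite -(perm_mem pm); exact: adj_labs h.
  have dT' : d \in labs T'.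
    rewrite (perm_mem (labs_perm T')) mem_cat; apply/orP; right.
    by apply/mapP; exists (d, x', y').
  have dl := rl_max p3' dT'.
  have xr : x != rl T' by clear -xd dl; lia.
  have [e [z hz]] := labs_adj xT' xr.
  have ez : z = y by rewrite -(fT' _ _ _ hz) (fT _ _ _ h).
  subst z; case: (ltngtP e d) => ed.
  - have := IH e ed T' T x y cT' cT fT' fT hz => h2.
    by have [ee _] := adj_fun u h h2; rewrite ee ltnn in ed.
  - by right; apply: (adj_greedy p4' (or_introl h') hz).
  by left; rewrite -ed.
move=> T T' x y cT cT' fT fT' h.
have [p1 p2 p3 p4] := cT; have [p1' p2' p3' p4'] := cT'.
have dn : d \in nlabs T.
  by apply/mapP; case: h => h; [exists (d, x, y) | exists (d, y, x)].
have [x' [y' h']] : exists x' y', (d, x', y') \in lnodes T'.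
  by apply: nlabs_node; rewrite (perm_mem p2') -(perm_mem p2).
have [//|lt] := step T T' x y x' y' cT cT' fT fT' h h'.
have [x1 [y1 h1]] := nlabs_node dn.
have [h2|lt'] := step T' T x' y' x1 y1 cT' cT fT' fT (or_introl h') h1.
  have u := chen_uniq uA hA cT.
  have [[e1 e2]|[e1 e2]] := adj_node_fun u h h1;
  have [[e3 e4]|[e3 e4]] := adj_node_fun u h2 h1; subst; by [left|right].
have u := chen_uniq uA hA cT.
have [[e1 e2]|[e1 e2]] := adj_node_fun u h h1; subst; clear -lt lt'; lia.
Qed.

Lemma is_canon_lsubt T p U : lsubt T p = Some U -> is_canon (lshape T) -> is_canon (lshape U).
Proof.
elim: p T => [|b p IH] [x|d l r] //=; try by move=> [<-].
by move=> /IH h /and3P[_ h1 h2]; apply: h; case: b.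
Qed.

Lemma chen_unique (A : seq nat) (c0 : nat) (f : nat -> nat) T T' :
  uniq A -> all (fun x => x < c0) A -> chen A c0 T -> chen A c0 T' -> follows f T -> follows f T' ->
  is_canon (lshape T) -> is_canon (lshape T') -> T = T'.
Proof.
move=> uA hA cT cT' fT fT' kT kT'.
have u := chen_uniq uA hA cT; have u' := chen_uniq uA hA cT'.
have [p1 p2 p3 p4] := cT; have [p1' p2' p3' p4'] := cT'.
have pm : perm_eq (labs T) (labs T').
  apply: perm_trans (labs_perm T) _; rewrite perm_sym.
  apply: perm_trans (labs_perm T') _; apply: perm_cat.
    by apply: perm_trans p1' _; rewrite perm_sym.
  by apply: perm_trans p2' _; rewrite perm_sym.
have er : rl T = rl T'.
  apply/eqP; rewrite eqn_leq (rl_max p3') ?(rl_max p3) ?(perm_mem pm) ?rl_labs //.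
  by rewrite -(perm_mem pm) rl_labs.
have leafn S p x : perm_eq (leaves (lshape S)) A -> lsubt S p = Some (LLeaf x) -> x \in A.
  move=> /perm_mem <-; elim: p S => [|b p IH] [z|d l r] //=.
    by move=> [->]; rewrite inE.
  by move=> /IH; rewrite mem_cat; case: b => ->; rewrite ?orbT.
have noden S p x l r : perm_eq (nlabs S) (iota c0 (size A).-1) ->
    lsubt S p = Some (LNode x l r) -> x \notin A.
  move=> hn /lsubt_lnodes h; have : x \in nlabs S by apply/mapP; exists (x, rl l, rl r).
  rewrite (perm_mem hn) mem_iota => /andP[h2 _]; apply/negP => /(allP hA).
  by rewrite ltnNge h2.
suff main U p U' p' : lsubt T p = Some U -> lsubt T' p' = Some U' -> rl U = rl U' -> U = U'.
  by apply: (main T [::] T' [::]).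
elim: U p U' p' => [x|c l IHl r IHr] p [x'|c' l' r'] p' //=.
- by move=> _ _ ->.
- by move=> h h' e; have := noden _ _ _ _ _ p2' h'; rewrite -e (leafn _ _ _ p1 h).
- by move=> h h' e; have := noden _ _ _ _ _ p2 h; rewrite e (leafn _ _ _ p1' h').
move=> h h' e; subst c'.
have hl : lsubt T (rcons p false) = Some l by rewrite lsubt_rcons h.
have hr : lsubt T (rcons p true) = Some r by rewrite lsubt_rcons h.
have hl' : lsubt T' (rcons p' false) = Some l' by rewrite lsubt_rcons h'.
have hr' : lsubt T' (rcons p' true) = Some r' by rewrite lsubt_rcons h'.
have a1 := chen_nodes_sub uA hA cT cT' fT fT' (or_introl (lsubt_lnodes h)).
have [[e1 e2]|[e1 e2]] := adj_node_fun u' a1 (lsubt_lnodes h').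
  by rewrite (IHl _ _ _ hl hl' (esym e1)) (IHr _ _ _ hr hr' (esym e2)).
(* Crossed case: canonicity of both trees would order the same two least leaves both ways. *)
have el := IHl _ _ _ hl hr' (esym e2); have er' := IHr _ _ _ hr hl' (esym e1).
have := is_canon_lsubt h kT; have := is_canon_lsubt h' kT'.
rewrite /= -el -er' => /and3P[k1 _ _] /and3P[k2 _ _].
by clear -k1 k2; lia.
Qed.

(** * The labelling computed by Psi *)

Lemma chen_perm A A' c T : perm_eq A A' -> chen A c T -> chen A' c T.
Proof.
move=> hp [h1 h2 h3 h4]; split=> //; first exact: perm_trans h1 hp.
by rewrite -(perm_size hp).
Qed.

Lemma chen_iota_uniq n T : chen (iota 1 n) n.+1 T -> uniq (labs T).
Proof.
apply: chen_uniq; first exact: iota_uniq.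
by apply/allP => x; rewrite mem_iota => /andP[_].
Qed.

Lemma chen_iota_labs n T : 0 < n -> chen (iota 1 n) n.+1 T ->
  perm_eq (labs T) (iota 1 (2 * n - 1)).
Proof.
move=> n0 [h1 h2 _ _]; apply: perm_trans (labs_perm T) _.
have -> : 2 * n - 1 = n + n.-1 by clear -n0; lia.
by rewrite iotaD; apply: perm_cat => //; rewrite size_iota in h2.
Qed.

Lemma chen_iota_mem n T x : 0 < n -> chen (iota 1 n) n.+1 T ->
  (x \in labs T) = (0 < x <= 2 * n - 1).
Proof. by move=> n0 hT; rewrite (perm_mem (chen_iota_labs n0 hT)) mem_iota; clear -n0; lia. Qed.

(** The labels exhaust 1 to 2n-1 and increase towards the root, which therefore takes the one label
    that the algorithm does not attribute. *)
Lemma chen_iota_root n T : 0 < n -> chen (iota 1 n) n.+1 T -> rl T = 2 * n - 1.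
Proof.
move=> n0 hT; have [_ _ h3 _] := hT.
have := rl_labs T; rewrite (chen_iota_mem _ n0 hT) => h.
have : 2 * n - 1 <= rl T by apply: (rl_max h3); rewrite (chen_iota_mem _ n0 hT); clear -n0; lia.
by clear -h n0; lia.
Qed.

Lemma chen_iota_node n T a U : chen (iota 1 n) n.+1 T -> lsubt T a = Some U ->
  is_node (lshape U) = (n < rl U).
Proof.
case=> h1 h2 _ _; case: U => [x|c l r] /= h.
  suff : x \in leaves (lshape T).
    by rewrite (perm_mem h1) mem_iota => h3; apply/esym/negbTE; clear -h3; lia.
  elim: a T h {h1 h2} => [|b a IH] [z|d l r] //=; first by move=> [->]; rewrite inE.
  by move=> /IH; rewrite mem_cat; case: b => ->; rewrite ?orbT.
have : c \in nlabs T by apply/mapP; exists (c, rl l, rl r) => //; exact: lsubt_lnodes h.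
by rewrite (perm_mem h2) mem_iota => /andP[-> _].
Qed.

Lemma chen_iota_adj n T c x y : 0 < n -> chen (iota 1 n) n.+1 T -> adj T c x y ->
  [/\ 0 < x <= 2 * n - 2, 0 < y <= 2 * n - 2 & x != y].
Proof.
move=> n0 hT h; have [_ _ h3 _] := hT; have [xc yc] := adj_increasing h3 h.
have cl : c \in labs T.
  rewrite (perm_mem (labs_perm T)) mem_cat; apply/orP; right; apply/mapP.
  by case: h => h; [exists (c, x, y)|exists (c, y, x)].
have := adj_labs h; have := adj_labs (adjC h); move: cl.
rewrite !(chen_iota_mem _ n0 hT) => h5 h6 h7.
split; [clear -h5 h7 xc; lia|clear -h5 h6 yc; lia|].
apply/eqP => e; subst y; have [p [b [l1 l2]]] := adj_lat h.
have := lat_inj (chen_iota_uniq hT) l1 l2 => /rcons_inj[].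
by case: b {l1 l2}.
Qed.

Lemma chen_iota_has_adj n T x : 0 < n -> chen (iota 1 n) n.+1 T ->
  0 < x <= 2 * n - 2 -> exists c y, adj T c x y.
Proof.
move=> n0 hT hx; apply: labs_adj; first by rewrite (chen_iota_mem _ n0 hT); clear -hx n0; lia.
by rewrite (chen_iota_root n0 hT); clear -hx n0; lia.
Qed.

(** Invariant of the labelling loop. It constrains membership only; the order of [L] is irrelevant
    because addresses and labels determine each other. *)
Definition labelled_upto (T : ltree) (m : nat) (L : seq (seq bool * nat)) : Prop :=
  forall a x, ((a, x) \in L) = (lat T a == Some x) && (x <= m).

Lemma lookup_upto T m L a : labelled_upto T m L ->
  lookup L a = if lat T a is Some x then if x <= m then Some x else None else None.
Proof.
move=> hL; rewrite /lookup.
have mf q : q \in [seq q <- L | q.1 == a] = (q.1 == a) && ((lat T a == Some q.2) && (q.2 <= m)).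
  by rewrite mem_filter; case: eqP => //= <-; rewrite -hL -surjective_pairing.
case: (lat T a) mf => [x|] mf; last first.
  by case: [seq q <- L | _] mf => //= q s /(_ q); rewrite inE eqxx andbF.
case: ifP => xm; case: [seq q <- L | _] mf => [|q s] mf //=.
- by have := mf (a, x); rewrite /= !eqxx xm.
- by have := mf q; rewrite inE eqxx => /esym/and3P[_ /eqP[->]].
by have := mf q; rewrite inE eqxx => /esym/and3P[_ /eqP[<-]]; rewrite xm.
Qed.

Lemma addr_of_upto T m L a x : uniq (labs T) -> labelled_upto T m L ->
  lat T a = Some x -> x <= m -> addr_of L x = a.
Proof.
move=> u hL ha xm; rewrite /addr_of.
have : (a, x) \in [seq q <- L | q.2 == x] by rewrite mem_filter eqxx hL ha eqxx.
case e : [seq q <- L | q.2 == x] => [|q s] //= _.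
have : q \in [seq q <- L | q.2 == x] by rewrite e inE eqxx.
rewrite mem_filter => /andP[/eqP e2]; rewrite [q]surjective_pairing e2 hL => /andP[/eqP h _].
exact: lat_inj u h ha.
Qed.

Lemma mem_leafaddrs T a x : (a, x) \in leafaddrs (lshape T) <-> lsubt T a = Some (LLeaf x).
Proof.
elim: T a x => [y|c l hl r hr] a x /=.
  rewrite inE; split; first by move=> /eqP[-> ->].
  by case: a => [|b a] //= [->].
rewrite mem_cat; split.
  by move=> /orP[] /mapP[[b z] h [-> ->]]; rewrite /=; [apply/hl|apply/hr].
case: a => [|[] a] //=.
  by move=> /hr h; apply/orP; right; apply/mapP; exists (a, x).
by move=> /hl h; apply/orP; left; apply/mapP; exists (a, x).
Qed.

Lemma leafaddrs_upto n T : chen (iota 1 n) n.+1 T ->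
  labelled_upto T n (leafaddrs (lshape T)).
Proof.
move=> hT a x; apply/idP/andP.
  move=> /mem_leafaddrs h; split; first by rewrite /lat h.
  by have := chen_iota_node hT h; rewrite /=; case: ltnP.
move=> [/eqP h xn]; apply/mem_leafaddrs; move: h; rewrite /lat.
case e : (lsubt T a) => [[y|c l r]|] //= -[]; first by move=> ->.
by move=> ec; have := chen_iota_node hT e; rewrite /= ec ltnNge xn.
Qed.

Lemma subt0 t : subt t [::] = Some t. Proof. by case: t. Qed.

Lemma mem_addrs t a : (a \in addrs t) = isSome (subt t a).
Proof.
elim: t a => [m x|m l hl r hr] [|b a] //=.
rewrite inE mem_cat /=; have injc (c : bool) : injective (cons c) by move=> u v [].
have ncl (c c' : bool) (s : seq (seq bool)) : c != c' -> (c :: a \in map (cons c') s) = false.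
  by move=> nc; apply/negbTE/mapP => -[z _ [e _]]; rewrite e eqxx in nc.
case: b => /=; [rewrite ncl // | rewrite orbC ncl //]; by rewrite /= (mem_map (injc _)) ?hl ?hr.
Qed.

(** The vertex labelled m+1 in [T] is eligible, its children being smaller. Any other eligible
    vertex has a label above m+1 in [T] and children labelled at most m, so greediness gives it a
    strictly larger key: the head of the sorted list is the right vertex, without ties. *)
Lemma chen_step_upto n m T L : 0 < n -> chen (iota 1 n) n.+1 T ->
  labelled_upto T m L -> n <= m -> m < 2 * n - 2 ->
  labelled_upto T m.+1 (chen_step (lshape T) L m.+1).
Proof.
move=> n0 hT hL nm mn; have u := chen_iota_uniq hT.
have [_ _ inc grd] := hT.
have : m.+1 \in labs T by rewrite (chen_iota_mem _ n0 hT); clear -mn; lia.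
case/labs_lat=> a0 ha0; have := ha0; rewrite /lat.
case e0 : (lsubt T a0) => [U|] //= [eU]; have := chen_iota_node hT e0.
rewrite eU ltnS nm; case: U e0 eU => // c l0 r0 e0 /= ec _; subst c.
(* The algorithm only looks at non-root vertices; the bound on [m] keeps m+1 below the root label
   2n-1. *)
have a00 : a0 != [::].
  apply/eqP => e; move: ha0; rewrite e /lat /= (chen_iota_root n0 hT) => -[]; clear -mn; lia.
have [] := inc _ _ _ (lsubt_lnodes e0); rewrite !ltnS => l0m r0m.
rewrite /chen_step; set cand := [seq a <- _ | _].
pose key a := minn (odflt 0 (lookup L (rcons a false))) (odflt 0 (lookup L (rcons a true))).
have lkE a b : lookup L (rcons a b) = if lsubt T a is Some (LNode c l r) then
    if rl (if b then r else l) <= m then Some (rl (if b then r else l)) else None else None.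
  by rewrite (lookup_upto _ hL) /lat lsubt_rcons; case: (lsubt T a) => [[x|c l r]|].
have candP a : a \in cand -> exists c l r, [/\ lsubt T a = Some (LNode c l r), m < c,
    rl l <= m, rl r <= m & key a = minn (rl l) (rl r)].
  rewrite mem_filter => /andP[/and3P[h1 h2 h3]]; rewrite mem_filter => /andP[/andP[h4 h5] _].
  move: h1 h2 h3 h5; rewrite /key !lkE (lookup_upto _ hL) subt_lshape /lat.
  case: (lsubt T a) => [[x|c l r]|] //= h1 h2 h3 _; exists c, l, r.
  move: h1 h2 h3; case: leqP => // mc _; case: leqP => // hl _; case: leqP => // hr _.
have k0 : key a0 = minn (rl l0) (rl r0) by rewrite /key !lkE e0 /= l0m r0m.
have c0 : a0 \in cand.
  rewrite mem_filter !lkE (lookup_upto _ hL) /lat e0 /= ltnn l0m r0m /=.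
  by rewrite mem_filter a00 subt_lshape e0 mem_addrs subt_lshape e0.
pose R a b := key a <= key b.
change (labelled_upto T m.+1 (if sort R cand is a :: _ then (a, m.+1) :: L else L)).
have Rtot : total R by move=> a b; apply: leq_total.
have Rtr : transitive R by move=> a b c; apply: leq_trans.
have := sort_sorted Rtot cand; have : a0 \in sort R cand by rewrite mem_sort.
have : {subset sort R cand <= cand} by move=> a; rewrite mem_sort.
case: (sort R cand) => // a s sub a0s srt.
have [c [l [r [e1 e2 e3 e4 e5]]]] := candP a (sub a (mem_head _ _)).
have ka : key a <= key a0.
  move: a0s; rewrite inE => /orP[/eqP <- //|h].
  by move: srt => /= /(order_path_min Rtr)/allP/(_ _ h).
have ea : a = a0.
  have [ec|nc] := eqVneq c m.+1.
    by apply: (lat_inj u (x := m.+1)) => //; rewrite /lat e1 /= ec.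
  have lt : m.+1 < c by clear -e2 nc; lia.
  have := grd _ _ _ _ _ _ (lsubt_lnodes e0) (lsubt_lnodes e1) lt.
  rewrite !ltnS => /(_ e3 e4); rewrite -k0 -e5 ltnNge => /negP; by rewrite ka.
rewrite ea => b x; rewrite inE hL xpair_eqE.
case: (altP (b =P a0)) => [->|nb] /=.
  rewrite ha0; case: (altP (x =P m.+1)) => [->|nx] /=; first by rewrite eqxx leqnn.
  by apply/andP/andP => -[/eqP[e]]; rewrite e eqxx in nx.
case: (altP (lat T b =P Some x)) => //= hb.
rewrite [in RHS]leq_eqVlt ltnS; case: eqP => // ex; subst x.
by rewrite (lat_inj u hb ha0) eqxx in nb.
Qed.

(** The invariant holds at n for the leaf labels, and each of the n-2 rounds raises it by one. *)
Lemma chen_labels_upto n T : 1 < n -> chen (iota 1 n) n.+1 T ->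
  labelled_upto T (2 * n - 2) (chen_labels (lshape T)).
Proof.
move=> n1 hT; have n0 := ltnW n1; have [h1 _ _ _] := hT.
rewrite /chen_labels (perm_size h1) size_iota.
suff main st i L : labelled_upto T (n + i) L -> n + i + st <= 2 * n - 2 ->
    labelled_upto T (n + i + st) (chen_iter (lshape T) L n i st).
  have -> : 2 * n - 2 = n + 0 + (n - 2) by clear -n1; lia.
  apply: main; last by clear -n1; lia.
  by rewrite addn0; exact: leafaddrs_upto.
elim: st i L => [|st IH] i L hL hb /=; first by rewrite addn0.
rewrite -addSnnS -addnS; apply: IH; last by clear -hb; lia.
have -> : n + 1 + i = (n + i).+1 by clear; lia.
rewrite addnS; apply: (chen_step_upto n0) => //; clear -hb; lia.
Qed.

Lemma sibling_rcons p b : sibling (rcons p b) = rcons p (~~ b).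
Proof.
rewrite /sibling size_rcons last_rcons /=; congr rcons.
by rewrite -cats1 take_size_cat.
Qed.

Lemma Psi_nth n T c x y : 1 < n -> chen (iota 1 n) n.+1 T -> adj T c x y ->
  nth 0 (Psi (lshape T)) x.-1 = y.
Proof.
move=> n1 hT h; have n0 := ltnW n1; have [h1 _ _ _] := hT.
have hL := chen_labels_upto n1 hT; have [xb yb _] := chen_iota_adj n0 hT h.
have [p [b [l1 l2]]] := adj_lat h.
rewrite /Psi (perm_size h1) size_iota (nth_map 0) ?size_iota; last by clear -xb; lia.
rewrite nth_iota; last by clear -xb; lia.
have -> : 1 + x.-1 = x by clear -xb; lia.
rewrite (addr_of_upto (chen_iota_uniq hT) hL l1); last by case/andP: xb.
by rewrite sibling_rcons (lookup_upto _ hL) l2; case/andP: yb => _ ->.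
Qed.

Lemma size_Psi n T : chen (iota 1 n) n.+1 T -> size (Psi (lshape T)) = 2 * n - 2.
Proof. by case=> h1 _ _ _; rewrite /Psi size_map size_iota (perm_size h1) size_iota. Qed.

(** * Marks located by address, and the values of the final matching *)

Definition marked_at (t : btree) (a : seq bool) : bool :=
  if subt t a is Some u then root_mark u else false.

Lemma count_marked t : count (marked_at t) (addrs t) = nmarks t.
Proof.
elim: t => [m x|m l hl r hr] /=; first by rewrite /marked_at /= addn0.
rewrite count_cat !count_map addnA -hl -hr; congr (_ + _ + _); rewrite //.
Qed.

Lemma marked_atE t a : nmarks t = 1 -> marked_at t a = (a == marked_addr t).
Proof.
move=> hm; rewrite /marked_addr -/(marked_at t).
have hs : size (filter (marked_at t) (addrs t)) = 1 by rewrite size_filter count_marked.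
have hf : marked_at t a = (a \in filter (marked_at t) (addrs t)).
  rewrite mem_filter mem_addrs /marked_at; case: (subt t a) => //= u; by rewrite andbT.
rewrite hf; case: (filter _ _) hs => [|b [|b' s]] //= _.
by rewrite inE.
Qed.

Lemma leaves_unmark t : leaves (unmark t) = leaves t.
Proof. by elim: t => //= m l -> r ->. Qed.
Lemma minleaf_unmark t : minleaf (unmark t) = minleaf t.
Proof. by elim: t => //= m l -> r ->. Qed.
Lemma is_canon_unmark t : is_canon (unmark t) = is_canon t.
Proof. by elim: t => //= m l -> r ->; rewrite !minleaf_unmark. Qed.
Lemma nmarks_unmark t : nmarks (unmark t) = 0.
Proof. by elim: t => //= m l -> r ->. Qed.
Lemma is_node_unmark t : is_node (unmark t) = is_node t.
Proof. by case: t. Qed.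
Lemma subt_unmark t a : subt (unmark t) a = omap unmark (subt t a).
Proof. by elim: t a => [m x|m l hl r hr] [|[] a] //=. Qed.

Lemma unmark_inj t t' : unmark t = unmark t' -> marked_at t =1 marked_at t' -> t = t'.
Proof.
elim: t t' => [m x|m l hl r hr] [m' x'|m' l' r'] //= [].
  by move=> -> h; have := h [::]; rewrite /marked_at /= => ->.
move=> el er h; have := h [::]; rewrite /marked_at /= => ->.
by congr BNode; [apply: hl => // a; exact: (h (false :: a)) |
                 apply: hr => // a; exact: (h (true :: a))].
Qed.

Fixpoint mark_at (a : seq bool) (t : btree) {struct a} : btree :=
  match a with
  | [::] => mark_root t
  | b :: a' => match t with
    | BLeaf m x => BLeaf m x
    | BNode m l r => if b then BNode m l (mark_at a' r) else BNode m (mark_at a' l) r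
    end
  end.

Lemma unmark_mark_at a t : unmark (mark_at a t) = unmark t.
Proof. by elim: a t => [|b a IH] [m x|m l r] //=; case: b; rewrite /= IH. Qed.

Lemma nmarks_mark_at a t : nmarks t = 0 -> isSome (subt t a) -> nmarks (mark_at a t) = 1.
Proof.
elim: a t => [|b a IH] [m x|m l r] //=.
  by move=> h _; clear -h; lia.
move=> hm; have [h0 h1 h2] : [/\ nat_of_bool m = 0, nmarks l = 0 & nmarks r = 0].
  by split; clear -hm; lia.
by case: b => hs /=; rewrite h0 ?h1 ?h2 IH.
Qed.

Lemma marked_at_mark_at a t : isSome (subt t a) -> marked_at (mark_at a t) a.
Proof.
elim: a t => [|b a IH] [m x|m l r] //=.
by case: b => h; apply: IH.
Qed.

Definition mate (pi : seq nat) (i : nat) : nat := nth 0 pi i.-1.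

(** The effect of the mark is expressed through the partners of 2n and 2n-1 alone, so that it can be
    read from the matching. With the root marked these two are partners of each other, and no label
    up to 2n-2 is diverted. *)
Lemma Psi'_spec n t T (pi := Psi' t) : 1 < n -> chen (iota 1 n) n.+1 T ->
  lshape T = unmark t -> nmarks t = 1 ->
  [/\ size pi = 2 * n, lat T (marked_addr t) = Some (mate pi (2 * n)),
      [/\ marked_addr t = [::], mate pi (2 * n) = 2 * n - 1
        & mate pi (2 * n - 1) = 2 * n] \/
      (marked_addr t <> [::] /\
       exists c, adj T c (mate pi (2 * n)) (mate pi (2 * n - 1)))
    & forall c x y, adj T c x y -> mate pi x =
      if x == mate pi (2 * n) then 2 * n
      else if x == mate pi (2 * n - 1) then 2 * n - 1 else y].
Proof.
move=> n1 hT sT hm; have n0 := ltnW n1; have [h1 _ _ _] := hT.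
have sz : size (leaves t) = n by rewrite -leaves_unmark -sT (perm_size h1) size_iota.
have i1 : (2 * n).-1 = (2 * n - 2).+1 by clear -n1; lia.
have i2 : (2 * n - 1).-1 = 2 * n - 2 by clear -n1; lia.
have sP := size_Psi hT; have hL := chen_labels_upto n1 hT.
have mA : marked_at t (marked_addr t) by rewrite marked_atE.
rewrite /pi /Psi' sz -sT; case: eqP => [ma|/eqP ma].
  rewrite /mate i1 i2 !nth_cat !sP ltnNge leqnSn ltnn subnn /= subSn // subnn /=.
  have ->: lat T (marked_addr t) = Some (2 * n - 1).
    by rewrite ma /lat /= (chen_iota_root n0 hT).
  split=> //; first by rewrite size_cat sP /=; clear -n1; lia.
    by left.
  move=> c x y h; have [xb yb _] := chen_iota_adj n0 hT h.
  rewrite nth_cat sP (Psi_nth n1 hT h); case: ifP => [_|]; last by clear -xb; lia.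
  do 2 (case: ifP => [/eqP|_]; first by clear -xb; lia).
  by [].
have [p [b ep]] : exists p b, marked_addr t = rcons p b.
  by case/lastP: (marked_addr t) ma => // p b _; exists p, b.
have [k hk] : exists k, lat T (rcons p b) = Some k.
  move: mA; rewrite /marked_at ep; case e : (subt t _) => [v|] // _.
  have := subt_lshape T (rcons p b); rewrite sT subt_unmark e /= /lat.
  by case: (lsubt T _) => // W _; exists (rl W).
have [c [l [akl hl]]] := lat_adj hk.
have [kb lb kl] := chen_iota_adj n0 hT akl.
have k2 : k <= 2 * n - 2 by case/andP: kb.
have l2 : l <= 2 * n - 2 by case/andP: lb.
rewrite ep sibling_rcons !(lookup_upto _ hL) hk hl k2 l2 /=.
rewrite /mate i1 i2 !nth_cat !size_map !size_iota ltnNge leqnSn ltnn subnn /= subSn // subnn /=.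
split=> //; first by rewrite size_cat size_map size_iota /=; clear -n1; lia.
  by right; split; [case: (p) | exists c].
move=> d x y h; have [xb yb _] := chen_iota_adj n0 hT h.
have xs : x.-1 < 2 * n - 2 by clear -xb; lia.
rewrite nth_cat size_map size_iota xs (nth_map 0) ?size_iota // nth_iota //.
have -> : 1 + x.-1 = x by clear -xb; lia.
by rewrite (Psi_nth n1 hT h).
Qed.

(** * Matchings and marked trees *)

Lemma is_matchingP m pi : reflect (size pi = m /\ forall i, 0 < i <= m ->
    [/\ 0 < mate pi i <= m, mate pi i != i & mate pi (mate pi i) = i])
  (is_matching m pi).
Proof.
apply: (iffP andP) => [[/eqP hs /allP h]|[hs h]]; split=> //; try exact/eqP.
  move=> i hi; have := h i; rewrite mem_iota add1n ltnS => /(_ hi).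
  by move=> /and4P[h1 h2 h3 /eqP h4]; rewrite h1 h2.
apply/allP => i; rewrite mem_iota add1n ltnS => /h[/andP[h1 h2] h3 h4].
by apply/and4P; split=> //; apply/eqP.
Qed.

(* The matching from which pi was obtained by diverting the partners of 2n-1 and 2n. *)
Definition unmate (n : nat) (pi : seq nat) (x : nat) : nat :=
  if x == mate pi (2 * n) then mate pi (2 * n - 1)
  else if x == mate pi (2 * n - 1) then mate pi (2 * n) else mate pi x.

(** The sibling matching of the labelled tree is thus a function of the final matching, which is
    what reduces injectivity to the uniqueness of Chen labellings. *)
Lemma Psi'_follows n t T : 1 < n -> chen (iota 1 n) n.+1 T ->
  lshape T = unmark t -> nmarks t = 1 -> follows (unmate n (Psi' t)) T.
Proof.
move=> n1 hT sT hm c x y h; have n0 := ltnW n1; have u := chen_iota_uniq hT.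
have [_ _ hr hx] := Psi'_spec n1 hT sT hm; have [xb yb _] := chen_iota_adj n0 hT h.
have := hx _ _ _ h; rewrite /unmate; case: hr => [[_ -> ->]|[_ [d hd]]].
  do 2 (case: ifP => [/eqP|_]; first by clear -xb; lia).
  by [].
case: eqP => [ex _|_]; first by subst x; have [_ ->] := adj_fun u h hd.
case: eqP => [ex _|//]; subst x.
by have [_ ->] := adj_fun u h (adjC hd).
Qed.

Lemma Psi'_matching n t T : 1 < n -> chen (iota 1 n) n.+1 T ->
  lshape T = unmark t -> nmarks t = 1 -> is_matching (2 * n) (Psi' t).
Proof.
move=> n1 hT sT hm; have n0 := ltnW n1; have u := chen_iota_uniq hT.
have [hs _ hr hx] := Psi'_spec n1 hT sT hm; apply/is_matchingP; split=> // i hi.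
have fu := Psi'_follows n1 hT sT hm.
set K := mate _ (2 * n) in hr hx; set L := mate _ (2 * n - 1) in hr hx.
have [i2|] : 0 < i <= 2 * n - 2 \/ 2 * n - 2 < i by clear -hi; lia.
  have [c [y h]] := chen_iota_has_adj n0 hT i2.
  have [_ yb xy] := chen_iota_adj n0 hT h.
  rewrite (hx _ _ _ h); case: eqP => [iK|iK].
    by split; [clear -n0; lia | clear -i2; lia | rewrite iK].
  case: eqP => [iL|iL].
    by split; [clear -n0; lia | clear -i2; lia | rewrite iL].
  have fi := fu _ _ _ (adjC h); rewrite (hx _ _ _ (adjC h)); rewrite /unmate -/K -/L in fi.
  split; [clear -yb; lia|by rewrite eq_sym|].
  case: (y =P K) fi => [_ fi|_]; first by case: iL.
  by case: (y =P L) => // _ fi; case: iK.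
move=> ib; have [->|->] : i = 2 * n - 1 \/ i = 2 * n by clear -hi ib; lia.
  rewrite -/L; case: hr => [[_ eK eL]|[_ [d hd]]].
    by rewrite eL -/K eK; split=> //; clear -n0; lia.
  have [Kb Lb KL] := chen_iota_adj n0 hT hd.
  have LK : (L == K) = false by rewrite eq_sym (negbTE KL).
  rewrite (hx _ _ _ (adjC hd)) eqxx LK.
  by split=> //; clear -Lb n0; lia.
rewrite -/K; case: hr => [[_ eK eL]|[_ [d hd]]].
  by rewrite eK -/L eL; split=> //; clear -n0; lia.
have [Kb Lb KL] := chen_iota_adj n0 hT hd.
by rewrite (hx _ _ _ hd) eqxx; split=> //; clear -Kb n0; lia.
Qed.

(** For a tree reduced to a leaf, [sibling [::]] is [[:: true]], which addresses no vertex, so the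
    value is false as wanted. *)
Definition qs_at (t : btree) (a : seq bool) : bool :=
  match subt t a, subt t (sibling a) with
  | Some u, Some v => is_qs u v
  | _, _ => false
  end.

Lemma leafaddrs_leaves t : [seq q.2 | q <- leafaddrs t] = leaves t.
Proof. by elim: t => //= m l <- r <-; rewrite map_cat -!map_comp. Qed.

Lemma leafaddrs_unmark t : leafaddrs (unmark t) = leafaddrs t.
Proof. by elim: t => //= m l -> r ->. Qed.

Lemma sibling_cons b a : a != [::] -> sibling (b :: a) = b :: sibling a.
Proof.
case/lastP: a => // p c _.
by rewrite -rcons_cons !sibling_rcons.
Qed.

Lemma leafaddrs_node t q : is_node t -> q \in leafaddrs t -> q.1 != [::].
Proof. by case: t => //= m l r _; rewrite mem_cat => /orP[] /mapP[q' _ ->]. Qed.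

Lemma count_qs t : count (fun q => qs_at t q.1) (leafaddrs t) = nqs t.
Proof.
elim: t => [m x|m l hl r hr] //=; rewrite count_cat !count_map.
have el : count (preim (fun q => (false :: q.1, q.2)) (fun q => qs_at (BNode m l r) q.1))
    (leafaddrs l) = is_qs l r + nqs l.
  case nl : (is_node l).
    rewrite is_qs_node // -hl; apply: eq_in_count => q hq /=.
    by rewrite /qs_at sibling_cons //; exact: leafaddrs_node hq.
  by case: l nl {hl} => // ml x _ /=; rewrite /qs_at /= subt0.
have er : count (preim (fun q => (true :: q.1, q.2)) (fun q => qs_at (BNode m l r) q.1))
    (leafaddrs r) = is_qs r l + nqs r.
  case nr : (is_node r).
    rewrite is_qs_node // -hr; apply: eq_in_count => q hq /=.
    by rewrite /qs_at sibling_cons //; exact: leafaddrs_node hq.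
  by case: r nr {hr el} => // mr x _ /=; rewrite /qs_at /= subt0.
by rewrite el er; clear; lia.
Qed.

Lemma Psi'_stat n t T : 1 < n -> chen (iota 1 n) n.+1 T ->
  lshape T = unmark t -> nmarks t = 1 ->
  count (fun i => n < nth 0 (Psi' t) i.-1 <= 2 * n - 1) (iota 1 n) = nqs t.
Proof.
move=> n1 hT sT hm; have n0 := ltnW n1; have u := chen_iota_uniq hT.
have [hs hK hr hx] := Psi'_spec n1 hT sT hm; have [p1 _ _ _] := hT.
have fu := Psi'_follows n1 hT sT hm.
have pl : perm_eq (leaves t) (iota 1 n) by rewrite -leaves_unmark -sT.
(* The labels 1 to n are enumerated through the leaves, so that both sides count the same list of
   addresses. *)
rewrite -count_qs -(permP pl) -leafaddrs_leaves count_map.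
apply: eq_in_count => -[a x] /=; rewrite -leafaddrs_unmark -sT => /mem_leafaddrs ha.
have xn : x <= n by have := chen_iota_node hT ha; rewrite /=; case: ltnP.
have hax : lat T a = Some x by rewrite /lat ha.
have [p [b ep]] : exists p b, a = rcons p b.
  case/lastP: a ha hax => [|p b] _; last by exists p, b.
  by rewrite /lat /= (chen_iota_root n0 hT) => -[e]; exfalso; clear -xn e n1; lia.
subst a; have [c [y [h hy]]] := lat_adj hax.
have [xb yb _] := chen_iota_adj n0 hT h.
have := subt_unmark t (rcons p b); rewrite -sT subt_lshape ha /=.
case eu : (subt t (rcons p b)) => [w|] //= [ew].
have mw : root_mark w = (rcons p b == marked_addr t) by rewrite -marked_atE // /marked_at eu.
have := subt_unmark t (rcons p (~~ b)); rewrite -sT subt_lshape; have := hy; rewrite /lat.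
case eV : (lsubt T (rcons p (~~ b))) => [V|] //= [eVy].
case ev : (subt t (rcons p (~~ b))) => [v|] //= [ewv].
have mv : root_mark v = (rcons p (~~ b) == marked_addr t) by rewrite -marked_atE // /marked_at ev.
have nv : is_node v = (n < y) by rewrite -is_node_unmark -ewv (chen_iota_node hT eV) eVy.
rewrite /qs_at eu sibling_rcons ev.
case: w ew mw {eu} => // mk z [ez] /= mw; rewrite mw mv nv.
rewrite -/(mate (Psi' t) x) (hx _ _ _ h).
set K := mate _ (2 * n) in hr hK *; set L := mate _ (2 * n - 1) in hr *.
(* Labels determine addresses, so the marks on the leaf and on its sibling become tests of [x]
   against the partners of 2n and 2n-1. *)
have -> : (rcons p b == marked_addr t) = (x == K).
  apply/eqP/eqP => [e|e]; last by apply: (lat_inj u hax); rewrite e.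
  by move: hK; rewrite -e hax => -[].
have -> : (rcons p (~~ b) == marked_addr t) = (x == L).
  apply/eqP/eqP => [e|e].
    have yK : y = K by move: hK; rewrite -e hy => -[].
    by have := fu _ _ _ (adjC h); rewrite /unmate -/K -/L yK eqxx.
  case: hr => [[_ _ eL]|[_ [d hd]]]; first by exfalso; clear -xb e eL n0; lia.
  have [_ eyK] := adj_fun u h (ltac:(rewrite e; exact: adjC hd) : adj T d x K).
  by apply: (lat_inj u hy); rewrite eyK.
case: eqP => _ /=; first by clear -n0; lia.
case: eqP => _ /=; first by clear -n1; lia.
by clear -yb; lia.
Qed.

Lemma marked_chen n t : perm_eq (leaves t) (iota 1 n) ->
  exists T, lshape T = unmark t /\ chen (iota 1 n) n.+1 T.
Proof.
move=> hp; have pu : perm_eq (leaves (unmark t)) (iota 1 n) by rewrite leaves_unmark.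
have [|||T [sT hT]] := @chen_exists (unmark t) n.+1.
- by rewrite (perm_uniq pu) iota_uniq.
- by apply/allP => x; rewrite (perm_mem pu) mem_iota => /andP[_].
- exact: nmarks_unmark.
by exists T; split=> //; apply: chen_perm hT.
Qed.

(** Either 2n-1 and 2n are partners and [unmate] agrees with the matching on the remaining labels,
    or their partners are two distinct labels up to 2n-2, which [unmate] pairs with each other. *)
Lemma unmate_matching n pi : 1 < n -> is_matching (2 * n) pi ->
  forall x, 0 < x <= 2 * n - 2 ->
  [/\ 0 < unmate n pi x <= 2 * n - 2, unmate n pi (unmate n pi x) = x & unmate n pi x != x].
Proof.
move=> n1 /is_matchingP[_ h] x hx.
have [k1 k2 k3] := h (2 * n) ltac:(clear -n1; lia).
have [l1 l2 l3] := h (2 * n - 1) ltac:(clear -n1; lia).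
have [x1 x2 x3] := h x ltac:(clear -hx; lia).
set K := mate pi (2 * n) in k1 k2 k3; set L := mate pi (2 * n - 1) in l1 l2 l3.
have KL : K <> L by move=> e; move: k3; rewrite e l3; clear -n1; lia.
have KLb : (K = 2 * n - 1 /\ L = 2 * n) \/ (K <= 2 * n - 2 /\ L <= 2 * n - 2).
  have [e|e] := eqVneq K (2 * n - 1).
    by left; split=> //; rewrite -k3 e.
  have e2 : L != 2 * n by apply: contraNneq e => e2; rewrite -l3 e2.
  by right; clear -e e2 k1 l1 k2 l2; lia.
rewrite /unmate -/K -/L; have [xK|xK] := eqVneq x K.
  have KLb' : K <= 2 * n - 2 /\ L <= 2 * n - 2 by clear -KLb xK hx n1; lia.
  rewrite eqxx; have -> : (L == K) = false by clear -KL; lia.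
  by split=> //; clear -KL KLb' l1 xK; lia.
have [xL|xL] := eqVneq x L.
  have KLb' : K <= 2 * n - 2 /\ L <= 2 * n - 2 by clear -KLb xL hx n1; lia.
  by rewrite eqxx; split=> //; clear -KL KLb' k1 xL; lia.
have m1 : mate pi x <> 2 * n by move=> e; move/eqP: xK; rewrite -x3 e.
have m2 : mate pi x <> 2 * n - 1 by move=> e; move/eqP: xL; rewrite -x3 e.
have m3 : mate pi x <> K by move=> e; move: x3; rewrite e k3; clear -hx n1; lia.
have m4 : mate pi x <> L by move=> e; move: x3; rewrite e l3; clear -hx n1; lia.
move/eqP/negbTE: m3 => ->; move/eqP/negbTE: m4 => ->; rewrite x3 x2.
by split=> //; clear -x1 m1 m2; lia.
Qed.

(** The labelled tree is built from [unmate n pi] and marked at the vertex labelled by the partner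
    of 2n. Such a vertex exists even if that partner is 2n-1, since the root carries this label. *)
Lemma Psi'_surj n pi : 1 < n -> is_matching (2 * n) pi ->
  exists t, [/\ perm_eq (leaves t) (iota 1 n), is_canon t, nmarks t = 1 & Psi' t = pi].
Proof.
move=> n1 hpi; have n0 := ltnW n1; have hf := unmate_matching n1 hpi.
have [||| |T0 [hT0 fT0]] := @chen_of_matching (unmate n pi) (n - 2) (iota 1 n) n.+1.
- exact: iota_uniq.
- by apply/allP => x; rewrite mem_iota => /andP[_].
- by rewrite size_iota; clear -n1; lia.
- rewrite -iotaD => x; rewrite !mem_iota => hx.
  have [|h1 h2 h3] := hf x; first by clear -hx n1; lia.
  by split=> //; clear -h1 n1; lia.
have hT := chen_lcanon hT0; have fT := follows_lcanon fT0; set T := lcanon T0 in hT fT.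
have [p1 _ _ _] := hT; have u := chen_iota_uniq hT.
have kT : is_canon (lshape T).
  rewrite lshape_lcanon is_canon_canon //; have [p0 _ _ _] := hT0.
  by rewrite (perm_uniq p0) iota_uniq.
have /is_matchingP[hs h] := hpi.
have [k1 k2 k3] := h (2 * n) ltac:(clear -n1; lia).
have [l1 l2 l3] := h (2 * n - 1) ltac:(clear -n1; lia).
have [ma hma] : exists a, lat T a = Some (mate pi (2 * n)).
  by apply: labs_lat; rewrite (chen_iota_mem _ n0 hT); clear -k1 k2; lia.
have sm : isSome (subt (lshape T) ma).
  by rewrite subt_lshape; move: hma; rewrite /lat; case: (lsubt T ma).
have ns : unmark (lshape T) = lshape T by elim: (T) => //= c l -> r ->.
have nm0 : nmarks (lshape T) = 0 by rewrite -ns nmarks_unmark.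
pose t := mark_at ma (lshape T).
have ut : unmark t = lshape T by rewrite unmark_mark_at.
have hm : nmarks t = 1 by apply: nmarks_mark_at.
have em : marked_addr t = ma.
  by have := marked_at_mark_at sm; rewrite -/t marked_atE // => /eqP.
exists t; split=> //.
- by rewrite -leaves_unmark ut.
- by rewrite -is_canon_unmark ut.
have [s1 s2 s3 s4] := Psi'_spec n1 hT (esym ut) hm.
have eK : mate (Psi' t) (2 * n) = mate pi (2 * n).
  by move: s2; rewrite em hma => -[].
(* With the mark at the root, 2n-1 and 2n are partners in both matchings. Otherwise the partner of
   2n-1 is the sibling of the marked label, and siblings follow [unmate n pi]. *)
have eL : mate (Psi' t) (2 * n - 1) = mate pi (2 * n - 1).
  case: s3 => [[_ e1 e2]|[_ [c hc]]].
    by rewrite e2; have := k3; rewrite -eK e1.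
  by have := fT _ _ _ hc; rewrite /unmate eK eqxx.
apply: (@eq_from_nth _ 0); first by rewrite s1 hs.
move=> i; rewrite s1 => hi; rewrite -[i]/(i.+1.-1) -!/(mate _ i.+1).
have [i2|] : 0 < i.+1 <= 2 * n - 2 \/ 2 * n - 2 < i.+1 by clear; lia.
  have [c [y hc]] := chen_iota_has_adj n0 hT i2.
  rewrite (s4 _ _ _ hc) eK eL; have := fT _ _ _ hc; rewrite /unmate.
  case: eqP => [->|_]; first by rewrite k3.
  by case: eqP => [->|_]; first by rewrite l3.
by move=> ib; have [->|->] : i.+1 = 2 * n - 1 \/ i.+1 = 2 * n by clear -hi ib; lia.
Qed.

Lemma Psi'_inj n t t' : 1 < n -> perm_eq (leaves t) (iota 1 n) ->
  perm_eq (leaves t') (iota 1 n) -> is_canon t -> is_canon t' ->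
  nmarks t = 1 -> nmarks t' = 1 -> Psi' t = Psi' t' -> t = t'.
Proof.
move=> n1 l1 l2 c1 c2 m1 m2 e.
have [T [sT hT]] := marked_chen l1; have [T' [sT' hT']] := marked_chen l2.
have fT := Psi'_follows n1 hT sT m1; have fT' := Psi'_follows n1 hT' sT' m2.
rewrite -e in fT'.
have eT : T = T'.
  apply: (chen_unique _ _ hT hT' fT fT'); first exact: iota_uniq.
  - by apply/allP => x; rewrite mem_iota => /andP[_].
  - by rewrite sT is_canon_unmark.
  by rewrite sT' is_canon_unmark.
subst T'; have [_ s1 _ _] := Psi'_spec n1 hT sT m1.
have [_ s2 _ _] := Psi'_spec n1 hT sT' m2; rewrite -e in s2.
have ea := lat_inj (chen_iota_uniq hT) s1 s2.
apply: unmark_inj; first by rewrite -sT.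
by move=> a; rewrite !marked_atE // ea.
Qed.

Lemma marked_tree1 k t : marked_tree 1 k t = (k == 0) && (if t is BLeaf true 1 then true else false).
Proof.
case: t => [m x|m l r].
  rewrite /marked_tree /= eq_sym; case: m; rewrite ?andbF //=.
  case: x => [|[|x]]; rewrite ?andbF ?andbT //=.
  by apply/negbTE/andP => -[/perm_mem/(_ 1)].
rewrite andbF; apply/negbTE/and4P => -[/perm_size hs _ _ _].
by have := @size_leaves_node (BNode m l r) isT; rewrite hs.
Qed.

Lemma Psi'_bij (n k : nat) : 0 < n -> bij_on (marked_tree n k) (matching_stat n k) Psi'.
Proof.
(* Size 1 is checked by hand: the root is then a leaf and already has its label 1 = 2n-1, so the
   labels do not stop at 2n-2 as they do for larger trees. *)
move=> n0; have [n1|] := ltnP 1 n; last first.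
  move=> n1; have -> : n = 1 by clear -n0 n1; lia.
  split; last split.
  - by case=> [[] [|[|x]]|m l r]; rewrite marked_tree1 ?andbF ?andbT // => /eqP ->.
  - move=> [[] [|[|x]]|m l r] [[] [|[|x']]|m' l' r'] //; rewrite !marked_tree1 ?andbF //.
  move=> pi /andP[/is_matchingP[hs h] hk]; exists (BLeaf true 1).
  case: pi hs h hk => [|x [|y [|z pi]]] // _ h.
  have [a1 a2 a3] := h 1 isT; have [b1 b2 b3] := h 2 isT; rewrite /mate /= in a1 a2 b1 b2.
  have -> : x = 2 by clear -a1 a2; lia.
  have -> : y = 1 by clear -b1 b2; lia.
  by move=> hk; split=> //; rewrite marked_tree1 andbT eq_sym.
split; last split.
- move=> t /and4P[hl hc /eqP hm hq]; have [T [sT hT]] := marked_chen hl.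
  by rewrite /matching_stat (Psi'_matching n1 hT sT hm) (Psi'_stat n1 hT sT hm).
- move=> t t' /and4P[hl hc /eqP hm _] /and4P[hl' hc' /eqP hm' _].
  exact: (Psi'_inj n1).
move=> pi /andP[hpi hk]; have [t [h1 h2 h3 h4]] := Psi'_surj n1 hpi.
exists t; split=> //; have [T [sT hT]] := marked_chen h1.
by rewrite /marked_tree h1 h2 h3 -(Psi'_stat n1 hT sT h3) h4.
Qed.

Theorem theorem5 (n k : nat) : 1 <= n ->
  bij_on (pos_path n k) (marked_tree n k) Phi' /\
  bij_on (marked_tree n k) (matching_stat n k) Psi'.
Proof. by move=> n1; split; [exact: Phi'_bij | exact: Psi'_bij]. Qed.
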